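(* Let $k$ be an algebraically closed field of characteristic $0$, let $m,r,s\ge1$ be integers, and let $\lambda,\mu$ be partitions of $t$ with $l(\mu)\le r$ and $l(\lambda)\le s$. Let $\Sigma_t$ be the set of $m$-tuples of integers $\ge0$ with sum $t$. For $\nu\in\Sigma_t$, $P,Q$ ordered tableaux of shapes $\lambda$ and $\mu$ respectively, both of weight $\nu$, and $\alpha:\mu\to\lambda$ a diagram mapping such that $P\circ\alpha=Q$, define $$u_{\nu,P,Q,\alpha}=\sum_{\pi\in C_\mu,\ \sigma\in C_\lambda}\mathrm{sgn}(\pi)\,\mathrm{sgn}(\sigma)\prod_{a\in\mu}x(Q(a))_{r-\pi(a)_1+1,\ \sigma(\alpha(a))_1}\ \in k[\mathrm{Mat}_{rs}^m].$$ Then the elements $u_{\nu,P,Q,\alpha}$, where for each triple $(\nu,P,Q)$ consisting of $\nu\in\Sigma_t$ and ordered tableaux $P,Q$ of shapes $\lambda$ and $\mu$ respectively, both of weight $\nu$, $\alpha$ goes through a set of representatives for the $m$-tuples of special semi-standard tableaux with shapes determined by $Q$ and weights determined by $P$, form a basis of $k[\mathrm{Mat}_{rs}^m]^{U_r\times U_s}_{(-\mu^{\rm rev},\lambda)}$.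
   Context: Varieties and actions. $\mathrm{Mat}_{rs}^m$ is the space of $m$-tuples of $r\times s$ matrices over $k$; $x(l)_{ij}$ is the $(i,j)$ matrix entry function of the $l$-th matrix component. $\mathrm{GL}_r\times\mathrm{GL}_s$ acts on $\mathrm{Mat}_{rs}^m$ by $((R,S)\cdot\underline A)_i=RA_iS^{-1}$ and on $k[\mathrm{Mat}_{rs}^m]$ by $((R,S)\cdot f)(\underline A)=f((R^{-1},S^{-1})\cdot\underline A)$. $T_n$, $U_n\le\mathrm{GL}_n$ are the subgroups of diagonal and of upper uni-triangular matrices; characters of $T_n$ are identified with $\mathbb Z^n$ via $D\mapsto\prod_iD_{ii}^{\chi_i}$. $M^{U_r\times U_s}_{\chi}$ is the space of $U_r\times U_s$-invariants of $T_r\times T_s$-weight $\chi$. In $(-\mu^{\rm rev},\lambda)$, $\mu$ is viewed as an $r$-tuple and $\lambda$ as an $s$-tuple (extended by zeros), and $-\mu^{\rm rev}=(-\mu_r,\ldots,-\mu_1)$. Diagrams and tableaux. A partition $\lambda$ of length $l(\lambda)$ is identified with its Young diagram $\{(i,j)\mid1\le i\le l(\lambda),1\le j\le\lambda_i\}$, $i$ being the row index (rows numbered from top to bottom) and $j$ the column index. For a box $b=(i,j)$, $b_1=i$ denotes its row index. A skew diagram is a set $\lambda/\mu$ of boxes of $\lambda$ not in $\mu$, for partitions $\mu\subseteq\lambda$. A tableau of shape $E$ is a map $E\to\{1,2,\ldots\}$; it is ordered if its entries are weakly increasing along rows (left to right) and down columns, and semi-standard if its entries are weakly increasing along rows and strictly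 increasing down columns. Its weight is the tuple whose $i$-th component is the number of occurrences of $i$ (extended with zeros if necessary). $C_\lambda\le\mathrm{Sym}(\lambda)$ is the column stabiliser: the permutations of the boxes of $\lambda$ preserving each column. A diagram mapping is a bijection between (skew) diagrams. For a skew diagram $E$, $S_E$ is the tableau of shape $E$ with all boxes in the $i$-th row filled with $i$. Special tableaux and admissible maps. Let $E,F$ be skew diagrams with the same number of boxes. A semi-standard tableau $S$ of shape $F$ with the same weight as $S_E$ is called special (relative to $E$) if $S=S_E\circ\alpha$ for some diagram mapping $\alpha:F\to E$ such that: (b) if for $a,b\in F$, $\alpha(b)$ occurs strictly below $\alpha(a)$ in the same column, then $b$ occurs in a strictly lower row than $a$. A diagram mapping $\alpha:F\to E$ is called admissible if: (b') if for $a,b\in F$, $\alpha(b)$ occurs strictly below $\alpha(a)$ in the same column, then $b$ occurs in a strictly lower row than $a$ and in a column to the left of $a$ or in the same column. (Every special semi-standard tableau of shape $F$ and weight that of $S_E$ can be written as $S_E\circ\alpha$ with $\alpha$ admissible.) Representatives. Let $P,Q$ be ordered tableaux of shapes $\lambda,\mu$, both of weight $\nu\in\Sigma_t$; then $P^{-1}(i)$ and $Q^{-1}(i)$ are skew diagrams with $\nu_i$ boxes. An $m$-tuple of special semi-standard tableaux with shapes determined by $Q$ and weights determined by $P$ is a tuple $(S_1,\ldots,S_m)$ where $S_i$ is a special semi-standard tableau (relative to $P^{-1}(i)$) of shape $Q^{-1}(i)$ and of weight equal to that of $S_{P^{-1}(i)}$. A diagram mapping $\alpha:\mu\to\lambda$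 with $P\circ\alpha=Q$ represents $(S_1,\ldots,S_m)$ if, with $\alpha_i:Q^{-1}(i)\to P^{-1}(i)$ the restriction of $\alpha$, one has $S_i=S_{P^{-1}(i)}\circ\alpha_i$ for all $i$; representatives are always required to have all $\alpha_i$ admissible. A set of representatives contains exactly one representative for each such $m$-tuple. *)

(* Defs.v *)
From HB Require Import structures.
From mathcomp Require Import all_boot all_order all_fingroup all_algebra.
From mathcomp Require Import mpoly.

Set Implicit Arguments.
Unset Strict Implicit.
Unset Printing Implicit Defensive.

Import GRing.Theory.
Local Open Scope ring_scope.

(* Rows, columns and tableau entries are numbered from 0 throughout. *)

Definition partition_of (t : nat) (la : seq nat) : Prop :=
  [/\ sorted geq la, 0%N \notin la & sumn la = t].

Definition box (la : seq nat) := {i : 'I_(size la) & 'I_(nth 0%N la i)}.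
HB.instance Definition _ (la : seq nat) := Finite.on (box la).

Definition brow (la : seq nat) (b : box la) : 'I_(size la) := tag b.
Definition bcol (la : seq nat) (b : box la) : nat := tagged b.

(* The boxes of a skew diagram, the latter given as a set of boxes of an
   ambient Young diagram; they keep their coordinates in that diagram. *)
Notation boxes E := {b | b \in E}.

Definition weight (X : finType) (Y : eqType) (T : X -> Y) (y : Y) : nat :=
  #|[set b | T b == y]|.

Definition ordered (la : seq nat) (m : nat) (T : box la -> 'I_m) : Prop :=
  (forall a b, brow a = brow b -> (bcol a <= bcol b)%N -> (T a <= T b)%N) /\
  (forall a b, bcol a = bcol b -> (brow a <= brow b)%N -> (T a <= T b)%N).

Definition semistandard (la : seq nat) (F : {set box la})
    (T : boxes F -> nat) : Prop :=
  (forall a b, brow (val a) = brow (val b) ->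
     (bcol (val a) <= bcol (val b))%N -> (T a <= T b)%N) /\
  (forall a b, bcol (val a) = bcol (val b) ->
     (brow (val a) < brow (val b))%N -> (T a < T b)%N).

Definition row_tableau (la : seq nat) (E : {set box la}) : boxes E -> nat :=
  fun b => brow (val b).

Definition special (la mu : seq nat) (E : {set box la}) (F : {set box mu})
    (S : boxes F -> nat) : Prop :=
  [/\ semistandard S,
      weight S =1 weight (@row_tableau la E) &
      exists alpha : boxes F -> boxes E,
        [/\ bijective alpha,
            S =1 (@row_tableau la E) \o alpha &
            forall a b, bcol (val (alpha a)) = bcol (val (alpha b)) ->
              (brow (val (alpha a)) < brow (val (alpha b)))%N ->
              (brow (val a) < brow (val b))%N]].

Definition admissible (la mu : seq nat) (E : {set box la}) (F : {set box mu})
    (alpha : boxes F -> boxes E) : Prop :=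
  bijective alpha /\
  forall a b, bcol (val (alpha a)) = bcol (val (alpha b)) ->
    (brow (val (alpha a)) < brow (val (alpha b)))%N ->
    (brow (val a) < brow (val b))%N /\ (bcol (val b) <= bcol (val a))%N.

Definition fiber (la : seq nat) (m : nat) (P : box la -> 'I_m) (i : 'I_m)
  : {set box la} := [set b | P b == i].

Section Representatives.
Variables (la mu : seq nat) (m : nat).
Variables (P : box la -> 'I_m) (Q : box mu -> 'I_m).

Definition tableau_tuple := forall i : 'I_m, boxes (fiber Q i) -> nat.

Definition special_tuple (S : tableau_tuple) : Prop :=
  forall i, special (fiber P i) (S i).

(* [alpha_i] is the restriction of [alpha] to the fibers over [i]. *)
Definition represents (alpha : box mu -> box la) (S : tableau_tuple) : Prop :=
  [/\ bijective alpha, P \o alpha =1 Q &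
      forall i, exists alpha_i : boxes (fiber Q i) -> boxes (fiber P i),
        [/\ forall b, val (alpha_i b) = alpha (val b),
            admissible alpha_i &
            S i =1 (@row_tableau la (fiber P i)) \o alpha_i]].

Definition set_of_representatives (A : {set {ffun box mu -> box la}}) : Prop :=
  (forall alpha, alpha \in A ->
     exists S, special_tuple S /\ represents alpha S) /\
  (forall S, special_tuple S ->
     exists! alpha : {ffun box mu -> box la}, alpha \in A /\ represents alpha S).

End Representatives.

Definition col_stab (la : seq nat) : {set {perm box la}} :=
  [set p : {perm box la} | [forall b, bcol (p b) == bcol b]].

Definition sgn (k : nzRingType) (X : finType) (p : {perm X}) : k :=
  (-1) ^+ (p : bool).

(* The coordinate ring of m-tuples of r x s matrices: one variable for each
   matrix entry. *)
Notation coord_ring k m r s := {mpoly k[#|{: 'I_m * 'I_r * 'I_s}|]}.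

Section CoordinateRing.
Variables (k : fieldType) (m r s : nat).
Local Notation kMat := (coord_ring k m r s).

Definition entry (l : 'I_m) (i : 'I_r) (j : 'I_s) : kMat :=
  'X_(enum_rank (l, i, j)).

Definition evalMat (f : kMat) (A : 'I_m -> 'M[k]_(r, s)) : k :=
  meval (fun n => let: (l, i, j) := enum_val n in A l i j) f.

Definition actMat (R : 'M[k]_r) (S : 'M[k]_s) (A : 'I_m -> 'M[k]_(r, s)) :
  'I_m -> 'M[k]_(r, s) := fun l => R *m A l *m invmx S.

(* (R, S) . f, as a function on matrix tuples; as polynomials over an infinite
   field are determined by their values, it is compared with f through [evalMat]. *)
Definition act_kMat (R : 'M[k]_r) (S : 'M[k]_s) (f : kMat) :
  ('I_m -> 'M[k]_(r, s)) -> k :=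
  fun A => evalMat f (actMat (invmx R) (invmx S) A).

Definition torus (n : nat) (D : 'M[k]_n) : bool :=
  is_diag_mx D && (D \in unitmx).

(* [is_trig_mx] is lower triangularity. *)
Definition upper_unitriangular (n : nat) (R : 'M[k]_n) : bool :=
  is_trig_mx R^T && [forall i, R i i == 1].

Definition torus_char (n : nat) (chi : 'I_n -> int) (D : 'M[k]_n) : k :=
  \prod_i D i i ^ chi i.

Definition highest_weight_space (chi : 'I_r -> int) (psi : 'I_s -> int)
    (f : kMat) : Prop :=
  (forall R S, upper_unitriangular R -> upper_unitriangular S ->
     act_kMat R S f =1 evalMat f) /\
  (forall D D', torus D -> torus D' ->
     act_kMat D D' f =1
       (fun A => torus_char chi D * torus_char psi D' * evalMat f A)).

(* In 0-based indexing the row index r - i + 1 becomes [rev_ord i]. *)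
Definition u_elt (la mu : seq nat) (hmu : (size mu <= r)%N)
    (hla : (size la <= s)%N) (Q : box mu -> 'I_m) (alpha : box mu -> box la)
  : kMat :=
  \sum_(p in col_stab mu) \sum_(q in col_stab la)
    (sgn k p * sgn k q) *:
      \prod_(a : box mu) entry (Q a) (rev_ord (widen_ord hmu (brow (p a))))
                                     (widen_ord hla (brow (q (alpha a)))).

End CoordinateRing.

(* The family v, indexed by the elements satisfying D, is a basis of the
   subspace W. *)
Definition is_basis (k : fieldType) (V : lmodType k) (I : eqType)
    (D : I -> Prop) (v : I -> V) (W : V -> Prop) : Prop :=
  [/\ forall i, D i -> W (v i),
      forall (e : seq I) (c : I -> k), uniq e -> (forall i, i \in e -> D i) ->
        \sum_(i <- e) c i *: v i = 0 -> forall i, i \in e -> c i = 0 &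
      forall w, W w -> exists (e : seq I) (c : I -> k),
        (forall i, i \in e -> D i) /\ w = \sum_(i <- e) c i *: v i].

(* P and Q have entries in 'I_m because nu is an m-tuple. *)
Definition triple (la mu : seq nat) (t m : nat) (nu : {ffun 'I_m -> nat})
    (P : {ffun box la -> 'I_m}) (Q : {ffun box mu -> 'I_m}) : Prop :=
  [/\ (\sum_i nu i)%N = t, ordered P, ordered Q, weight P =1 nu &
      weight Q =1 nu].

(* Main.v *)
(* Proof idea. Give the variable x(l)_{r-1-i, j} (indices from 0) the weight
   N (m-l)(r-i) + N (m-l)(s-j) + (r-i)(s-j) with N large; all minors of the
   matrices [A_1 | ... | A_m] and of their stacked version then have their
   diagonal term as leading term.

   Leading terms of the u's: the column-preserving rearrangements pi, sigma can
   only lower the weight of the monomial of (Q, alpha).  Admissibility of alpha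
   says that moving boxes down in the columns of P^-1(l) moves their
   alpha-preimages weakly to the left, and counting the boxes a of Q^-1(l) with
   pi(a) in the first i rows and sigma(alpha(a)) in the first j rows gives the
   bound; equality forces sigma alpha = alpha pi and Q pi = Q, so all the
   contributions to the leading term have sign +1.  The leading monomial
   determines P, Q and the special tableaux, so linear independence follows.

   Spanning: let M be a monomial of maximal weight in a highest weight vector f.
   The Garnir relations of sl_2 express the coefficient of a monomial violating a
   lattice condition through coefficients of monomials of larger weight, so M
   satisfies the lattice conditions for rows and for columns.  Sorting the letters
   of M along the rows of mu and of la yields Q, P and two semi-standard
   fillings, and matching them letter by letter yields a special tuple; hence M
   is the leading monomial of one of the u's, which is subtracted from f. *)
Require Import Defs.
From HB Require Import structures.
From mathcomp Require Import all_boot all_order all_fingroup all_algebra.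
From mathcomp Require Import mpoly.
From mathcomp Require Import zify.

Set Implicit Arguments.
Unset Strict Implicit.
Unset Printing Implicit Defensive.

Import GRing.Theory.
Local Open Scope ring_scope.

(** * Boxes and column rearrangements *)

Lemma box_exists (la : seq nat) (i j : nat) :
  (j < nth 0 la i)%N -> exists b : box la, brow b = i :> nat /\ bcol b = j.
Proof.
move=> lt_j; have lt_i : (i < size la)%N.
  by rewrite ltnNge; apply: contraTN lt_j => le_i; rewrite nth_default.
by exists (existT _ (Ordinal lt_i) (Ordinal lt_j)).
Qed.

Lemma box_inj (la : seq nat) (a b : box la) :
  brow a = brow b :> nat -> bcol a = bcol b -> a = b.
Proof.
case: a b => [i x] [j y]; rewrite /brow /bcol /= => /val_inj eq_ij.
by subst j => /val_inj ->.
Qed.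

Lemma bcol_lt (la : seq nat) (b : box la) : (bcol b < nth 0 la (brow b))%N.
Proof. exact: ltn_ord. Qed.

Lemma box_left (la : seq nat) (b : box la) (j : nat) : (j <= bcol b)%N ->
  exists b' : box la, brow b' = brow b :> nat /\ bcol b' = j.
Proof. by move=> le_j; apply/box_exists/(leq_ltn_trans le_j)/bcol_lt. Qed.

Lemma box_above (la : seq nat) (b : box la) (i : nat) : sorted geq la ->
  (i <= brow b)%N -> exists b' : box la, brow b' = i :> nat /\ bcol b' = bcol b.
Proof.
move=> la_sorted le_i; apply/box_exists/(leq_trans (bcol_lt b)).
have geq_trans : transitive geq by move=> y x z le_yx le_zy; apply: leq_trans le_yx.
apply: (sorted_leq_nth geq_trans (fun=> leqnn _) 0 la_sorted) => //;
  rewrite inE; last exact: ltn_ord.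
exact: leq_ltn_trans le_i (ltn_ord _).
Qed.

Lemma col_stabE (la : seq nat) (p : {perm box la}) b :
  p \in col_stab la -> bcol (p b) = bcol b.
Proof. by rewrite inE => /forallP/(_ b)/eqP. Qed.

(** Both counts split along [G]. Inside [G] the bound is the hypothesis on [X] and [X0], since
    [X0 :&: G] lies in [A]. Outside [G], [p] permutes [F :\: G], so at most [#|(F :&: A) :\: G|]
    elements are sent into [A], and [X0] contains that whole set. Equality forces equality in both
    pieces. *)
Lemma count_exchange (T : finType) (p : {perm T}) (F G A X X0 : {set T}) :
    (forall a, (p a \in F) = (a \in F)) -> (forall a, (p a \in G) = (a \in G)) ->
    X \subset F -> X0 \subset F -> (#|X :&: G| <= #|X0 :&: G|)%N ->
    X0 :&: G \subset A -> (F :&: A) :\: G \subset X0 ->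
  (#|[set a in X | p a \in A]| <= #|X0 :&: A|)%N /\
  (#|[set a in X | p a \in A]| = #|X0 :&: A| ->
     #|X :&: G| = #|X0 :&: G| /\
     forall a, a \in F -> a \notin G -> p a \in A -> a \in X).
Proof.
move=> pF pG sXF sX0F le_XG sX0GA sFAG.
pose H := [set a in F | (p a \in A) && (a \notin G)].
have card_H : #|H| = #|(F :&: A) :\: G|.
  rewrite -[RHS](card_preimset _ (@perm_inj _ p)); apply: eq_card => a.
  by rewrite !inE pF pG [RHS]andbC andbA.
have -> : #|X0 :&: A| = (#|X0 :&: G| + #|H|)%N.
  rewrite -(cardsID G) card_H; congr (_ + _)%N; apply: eq_card => a.
    rewrite !inE andbAC; apply: andb_idr => X0Ga.
    by apply: (subsetP sX0GA); rewrite inE.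
  rewrite !inE; case Ga: (a \in G) => //=.
  case Aa: (a \in A); rewrite ?andbF //= !andbT.
  apply/idP/idP => [/(subsetP sX0F) //|Fa].
  by apply: (subsetP sFAG); rewrite !inE Ga Fa.
rewrite -(cardsID G [set a in X | p a \in A]).
have s1 : [set a in X | p a \in A] :&: G \subset X :&: G.
  by apply/setSI/subsetP => a; rewrite inE => /andP[].
have s2 : [set a in X | p a \in A] :\: G \subset H.
  apply/subsetP => a; rewrite !inE => /and3P[-> Xa ->].
  by rewrite (subsetP sXF).
have := (subset_leq_card s1, subset_leq_card s2) => -[c1 c2].
split; first exact: leq_add (leq_trans c1 le_XG) c2.
move=> eq_c; split; first by lia.
have eqH : [set a in X | p a \in A] :\: G = H by apply/eqP; rewrite eqEcard s2; lia.
move=> a Fa nGa Apa; have : a \in H by rewrite inE Fa Apa.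
by rewrite -eqH !inE => /and3P[].
Qed.

(** Apply [count_exchange] with [X = X0 = K] and [A j] the rows up to [j]. In a column of [G j] some
    box of [F] outside [K] occurs in these rows, so all of [K] in that column lies above it; in any
    other column [K] contains every box of [F] in these rows. *)
Lemma col_upset_count (la : seq nat) (q : {perm box la}) (F K : {set box la}) :
    q \in col_stab la -> (forall b, (q b \in F) = (b \in F)) -> K \subset F ->
    (forall b b', b \in K -> b' \in F -> bcol b' = bcol b ->
       (brow b' <= brow b)%N -> b' \in K) ->
  (forall j, #|[set b in K | brow (q b) <= j]| <=
             #|[set b in K | brow b <= j]|)%N /\
  ((forall b, q b \in K ->
      #|[set b' in K | (brow (q b') <= brow (q b))%N]| =
      #|[set b' in K | (brow b' <= brow (q b))%N]|) ->
   forall b, q b \in K -> b \in K).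
Proof.
move=> qC qF sKF Kup.
pose A j := [set b : box la | (brow b <= j)%N].
pose G j := [set b : box la |
  [exists b', [&& b' \in A j, b' \in F, b' \notin K & bcol b' == bcol b]]].
have setA j : [set b in K | (brow b <= j)%N] = K :&: A j.
  by apply/setP => b; rewrite !inE.
have setqA j : [set b in K | (brow (q b) <= j)%N] = [set b in K | q b \in A j].
  by apply/setP => b; rewrite !inE.
have H j : (#|[set a in K | q a \in A j]| <= #|K :&: A j|)%N /\
  (#|[set a in K | q a \in A j]| = #|K :&: A j| ->
     #|K :&: G j| = #|K :&: G j| /\
     forall a, a \in F -> a \notin G j -> q a \in A j -> a \in K).
  apply: count_exchange => //.
  - by move=> b; rewrite !inE; under eq_existsb do rewrite (col_stabE _ qC).
  - apply/subsetP => b /setIP[Kb]; rewrite inE => /existsP[b' /and4P[Ab' Fb' nKb' /eqP cb']].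
    rewrite inE in Ab'; rewrite inE leqNgt; apply: contra nKb' => lt_jb.
    by apply: (Kup b) => //; apply: leq_trans Ab' (ltnW lt_jb).
  - apply/subsetP => b /setDP[/setIP[Fb Ab] nGb].
    apply: contraR nGb => nKb; rewrite inE; apply/existsP; exists b.
    by rewrite Ab Fb nKb eqxx.
split=> [j|eqK b Kqb]; first by rewrite setA setqA; case: (H j).
have := eqK b Kqb; rewrite setA setqA => /(proj2 (H _))[_]; apply.
- by rewrite -qF (subsetP sKF).
- rewrite inE negb_exists; apply/forallP => b'; apply/and4P => -[Ab' Fb' nKb' /eqP cb'].
  rewrite inE in Ab'; case/negP: nKb'; apply: (Kup (q b)) => //.
  by rewrite (col_stabE _ qC).
- by rewrite inE.
Qed.

Lemma sum_leq_eq (I : finType) (f g : I -> nat) :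
  (forall i, (f i <= g i)%N) -> (\sum_i f i = \sum_i g i)%N -> f =1 g.
Proof.
move=> le_fg eq_fg i; apply/eqP; rewrite eqn_leq le_fg /= leqNgt; apply/negP => lt_i.
have := eq_fg; rewrite (bigD1 i) //= [RHS](bigD1 i) //=.
have : (\sum_(j | j != i) f j <= \sum_(j | j != i) g j)%N by apply: leq_sum.
by lia.
Qed.

(** Summed over [T] both sides agree, so no single inequality is strict. *)
Lemma perm_increasing_eq (T : finType) (p : {perm T}) (h : T -> nat) :
  (forall a, (h a <= h (p a))%N) -> forall a, h (p a) = h a.
Proof.
move=> le_h a; rewrite -(sum_leq_eq le_h) //.
by rewrite [LHS](reindex_inj (@perm_inj _ p)).
Qed.

(** A product [(B - f a) * (R - g a)] counts the pairs [(c, d)] of the rectangle with [f a <= c] and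
    [g a <= d]. This turns comparisons of weights into comparisons of counts. *)
Lemma sum_mul_counts (T : finType) (F : {set T}) (f g : T -> nat) (B R : nat) :
  (\sum_(a in F) (B - f a) * (R - g a) =
   \sum_(c < B) \sum_(d < R) #|[set a in F | (f a <= c) && (g a <= d)]|)%N.
Proof.
have subE C x : (C - x = \sum_(c < C) (x <= c))%N.
  elim: C => [|C IH]; first by rewrite big_ord0.
  by rewrite big_ord_recr /= -IH; lia.
have cardE c d : (#|[set a in F | (f a <= c) && (g a <= d)]| =
    \sum_(a in F) (f a <= c) * (g a <= d))%N.
  rewrite -sum1_card big_mkcond [RHS]big_mkcond; apply: eq_bigr => a _.
  by rewrite inE; case: (a \in F) => //=; case: (f a <= c)%N; case: (g a <= d)%N.
under [RHS]eq_bigr do under eq_bigr do rewrite cardE.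
under [RHS]eq_bigr do rewrite exchange_big.
rewrite exchange_big; apply: eq_bigr => a _ /=.
rewrite (subE B) (subE R) big_distrl; apply: eq_bigr => c _.
by rewrite big_distrr.
Qed.

(** A rearrangement inequality: the sublevel sets [K c] of [h] are up-closed in columns, so
    [col_upset_count] bounds each layer of the sum. Equality in every layer gives [h b <= h (q b)]
    for all [b], hence equality because [q] is a permutation. *)
Lemma column_rearrangement (la : seq nat) (q : {perm box la}) (h : box la -> nat)
    (B R : nat) :
    q \in col_stab la -> (size la <= R)%N -> (forall b, h b < B)%N ->
    (forall a b, bcol a = bcol b -> (brow a <= brow b)%N -> (h a <= h b)%N) ->
  (\sum_b (B - h b) * (R - brow (q b)) <= \sum_b (B - h b) * (R - brow b))%N /\
  ((\sum_b (B - h b) * (R - brow (q b)) = \sum_b (B - h b) * (R - brow b))%N ->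
    forall b, h (q b) = h b).
Proof.
move=> qC leR ltB h_col.
pose K c := [set b : box la | (h b <= c)%N].
have H c := @col_upset_count la q setT (K c) qC.
have {}H c : (forall j, #|[set b in K c | brow (q b) <= j]| <=
             #|[set b in K c | brow b <= j]|)%N /\
  ((forall b, q b \in K c ->
      #|[set b' in K c | (brow (q b') <= brow (q b))%N]| =
      #|[set b' in K c | (brow b' <= brow (q b))%N]|) ->
   forall b, q b \in K c -> b \in K c).
  apply: H => [b||b b']; rewrite ?inE ?subsetT //.
  by move=> le_c _ eq_c le_r; apply: leq_trans le_c; apply: h_col.
have sumE (g : box la -> nat) : (\sum_b (B - h b) * (R - g b) =
    \sum_(c < B) \sum_(d < R) #|[set b in K c | g b <= d]|)%N.
  have := sum_mul_counts setT h g B R; rewrite (eq_bigl xpredT) => [->|b]; last by rewrite inE.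
  apply: eq_bigr => c _; apply: eq_bigr => d _; apply: eq_card => b.
  by rewrite !inE.
rewrite (sumE (fun b => brow (q b))) (sumE (fun b => brow b)).
have leH c : (\sum_(d < R) #|[set b in K c | brow (q b) <= d]| <=
   \sum_(d < R) #|[set b in K c | brow b <= d]|)%N by apply: leq_sum => d _; case: (H c).
split=> [|/(sum_leq_eq (fun c : 'I_B => leH c)) eqs]; first by apply: leq_sum.
apply: perm_increasing_eq => b.
pose c := Ordinal (ltB (q b)).
have : b \in K c; last by rewrite inE.
apply: (proj2 (H c)); last by rewrite inE.
move=> b' _; have ltR : (brow (q b') < R)%N by apply: leq_trans leR.
by have /(_ (Ordinal ltR)) := sum_leq_eq (fun d : 'I_R => proj1 (H c) d) (eqs c).
Qed.

(** * Weights of pictures *)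

(* The fiberwise conditions on a representative, read on the whole diagrams. *)
Definition picture (la mu : seq nat) (m : nat) (P : box la -> 'I_m)
    (Q : box mu -> 'I_m) (alpha : box mu -> box la) : Prop :=
  [/\ bijective alpha, P \o alpha =1 Q, ordered P /\ ordered Q,
      (forall a b, Q a = Q b -> brow a = brow b -> (bcol a <= bcol b)%N ->
         (brow (alpha a) <= brow (alpha b))%N) /\
      (forall a b, Q a = Q b -> bcol a = bcol b -> (brow a < brow b)%N ->
         (brow (alpha a) < brow (alpha b))%N) &
      forall a b, Q a = Q b -> bcol (alpha a) = bcol (alpha b) ->
        (brow (alpha a) < brow (alpha b))%N ->
        (brow a < brow b)%N /\ (bcol b <= bcol a)%N].

Section LeadingTerm.
Variables (la mu : seq nat) (m : nat) (P : box la -> 'I_m) (Q : box mu -> 'I_m).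
Variable alpha : box mu -> box la.
Hypothesis pict : picture P Q alpha.

(** The box [c] in the row of [b] and the column of [a] lies in the same fiber because [Q] is
    ordered; go down from [a] to [c], then right to [b]. *)
Lemma picture_corner a b : Q a = Q b -> (brow a <= brow b)%N ->
  (bcol a <= bcol b)%N -> (brow (alpha a) <= brow (alpha b))%N.
Proof.
case: pict => _ _ [_ [Qrow Qcol]] [Srow Scol] _ eQ le_r le_c.
have [c [rc cc]] := box_left le_c.
have rcb : brow c = brow b by apply: val_inj.
have Qac : (Q a <= Q c)%N by apply: Qcol; rewrite ?cc // rc.
have Qcb : (Q c <= Q b)%N by apply: Qrow; rewrite ?cc.
have Qc : Q c = Q a by apply: val_inj; rewrite /= eQ in Qac *; lia.
apply: (@leq_trans (brow (alpha c))); last by apply: Srow; rewrite ?cc // Qc.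
move: le_r; rewrite leq_eqVlt => /predU1P[eq_r|lt_r].
  by rewrite (box_inj (a := a) (b := c)) ?rc ?cc.
by apply/ltnW/Scol; rewrite ?cc ?rc.
Qed.

Variables (p : {perm box mu}) (q : {perm box la}).
Hypotheses (pC : p \in col_stab mu) (qC : q \in col_stab la).
Hypotheses (Qp : forall a, Q (p a) = Q a) (Pq : forall b, P (q b) = P b).

Let F l := [set a | Q a == l].
Let X l j := [set a in F l | (brow (q (alpha a)) <= j)%N].
Let X0 l j := [set a in F l | (brow (alpha a) <= j)%N].
Let A i := [set a : box mu | (brow a <= i)%N].

Let pF l a : (p a \in F l) = (a \in F l).
Proof. by rewrite !inE Qp. Qed.

(** Transport to [la] by [alpha]: by admissibility, going up in a column of a fiber of [P] moves the
    preimage weakly to the right, so the boxes of the fiber whose preimage lies in the columns of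
    [G] are up-closed, and [col_upset_count] applies to [q]. *)
Lemma count_right_columns (G : pred nat) l j :
    (forall c c', (c <= c')%N -> G c -> G c') ->
  (#|X l j :&: [set a | G (bcol a)]| <= #|X0 l j :&: [set a | G (bcol a)]|)%N.
Proof.
move=> Gup; have [[beta alphaK betaK] PalphaE _ _ adm] := pict.
have Pal a : P (alpha a) = Q a by apply: PalphaE.
have Qbe b : Q (beta b) = P b by rewrite -Pal betaK.
have cardE (K : {set box la}) : #|alpha @^-1: K| = #|K|.
  by apply: on_card_preimset; exists beta => b _; rewrite ?alphaK ?betaK.
pose K := [set b | (P b == l) && G (bcol (beta b))].
have := @col_upset_count la q [set b | P b == l] K qC.
case=> [b|||/(_ j) + _]; rewrite ?inE ?Pq //.
- by apply/subsetP => b; rewrite !inE => /andP[].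
- move=> b b'; rewrite !inE => /andP[/eqP Pb Gb] /eqP Pb' cb le_r.
  rewrite Pb' eqxx /=.
  move: le_r; rewrite leq_eqVlt => /predU1P[eq_r|lt_r].
    by rewrite (box_inj (a := b') (b := b)).
  have [] := adm (beta b') (beta b); rewrite ?betaK ?Qbe ?Pb ?Pb' // => _ le_c.
  exact: Gup Gb.
- rewrite -cardE -[X in (_ <= X)%N -> _]cardE.
  congr (_ <= _)%N; apply: eq_card => a; rewrite !inE Pal alphaK;
    by rewrite andbAC.
Qed.

Lemma fiber_count l i j :
  (#|[set a in F l | ((brow (p a) <= i) && (brow (q (alpha a)) <= j))%N]| <=
   #|[set a in F l | ((brow a <= i) && (brow (alpha a) <= j))%N]|)%N.
Proof.
(* [G] selects the columns such that no box of [X0 l j] below row [i] lies in that column or to its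
   right. Boxes of [X0 l j] in [G] thus lie in rows up to [i], while a box of the fiber in these
   rows outside [G] is north-west of a box of [X0 l j] and belongs to it by [picture_corner]. *)
pose G c := ~~ [exists b in X0 l j, (i < brow b)%N && (c <= bcol b)%N].
have [] := @count_exchange _ p (F l) [set a | G (bcol a)] (A i) (X l j) (X0 l j).
- exact: pF.
- by move=> a; rewrite !inE (col_stabE _ pC).
- by apply/subsetP => a; rewrite !inE => /andP[].
- by apply/subsetP => a; rewrite !inE => /andP[].
- apply: count_right_columns => c c' le_c; apply: contra => /existsP[b /and3P[Xb lt_i le_b]].
  by apply/existsP; exists b; rewrite Xb lt_i (leq_trans le_c).
- apply/subsetP => a /setIP[Xa]; rewrite inE => /existsPn/(_ a).
  by rewrite Xa leqnn andbT /= -leqNgt inE.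
- apply/subsetP => a; rewrite !inE negbK => /andP[/existsP[b /and3P[]]].
  rewrite !inE => /andP[/eqP Qb le_j] lt_i le_c /andP[/eqP Qa le_i].
  rewrite Qa eqxx; apply: leq_trans le_j; apply: picture_corner => //; first by rewrite Qa.
  by apply: ltnW; apply: leq_ltn_trans lt_i.
move=> + _; congr (_ <= _)%N; apply: eq_card => a; rewrite !inE.
  by rewrite andbAC -andbA.
by rewrite andbAC -andbA.
Qed.

Hypothesis eq_counts : forall l i j, (i < size mu)%N -> (j < size la)%N ->
  #|[set a in F l | ((brow (p a) <= i) && (brow (q (alpha a)) <= j))%N]| =
  #|[set a in F l | ((brow a <= i) && (brow (alpha a) <= j))%N]|.

(** Descending induction on [c]. If column [c] meets [X0 l j], cutting the rows at its lowest box
    there puts [count_exchange] in its equality case. If not, the count for [X0 l j] is the one for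
    [c.+1], and the two inequalities close up. *)
Lemma eq_count_right_columns l j c : (j < size la)%N ->
  #|X l j :&: [set a | (c <= bcol a)%N]| = #|X0 l j :&: [set a | (c <= bcol a)%N]|.
Proof.
move=> lt_j; have le_cnt c' := @count_right_columns (leq c') l j.
pose c0 := (\max_(a : box mu) (bcol a).+1)%N.
have [n] := ubnP (c0 - c); elim: n c => // n IH c lt_n.
apply/eqP; rewrite eqn_leq le_cnt /=; last by move=> x y le_xy le_cx; apply: leq_trans le_xy.
have [le_c|lt_c] := leqP c0 c.
  rewrite (_ : X0 l j :&: _ = set0) ?cards0 //; apply/setP => a; rewrite !inE.
  apply/negP => /andP[_ le_ca]; have := leq_bigmax (F := fun a => (bcol a).+1) a.
  by rewrite -/c0; lia.
have [/existsP[b0 b0P]|noc] := boolP [exists b in X0 l j, bcol b == c].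
  case: (@arg_maxnP _ b0 (fun b => (b \in X0 l j) && (bcol b == c)) (fun b => brow b) b0P).
  move=> b /andP[Xb /eqP cb] bmax.
  move: (Xb); rewrite !inE => /andP[/eqP Qb le_bj].
  have [] := @count_exchange _ p (F l) [set a | (c <= bcol a)%N] (A (brow b)) (X l j) (X0 l j).
  - exact: pF.
  - by move=> a; rewrite !inE (col_stabE _ pC).
  - by apply/subsetP => a; rewrite !inE => /andP[].
  - by apply/subsetP => a; rewrite !inE => /andP[].
  - by apply: le_cnt => x y le_xy le_cx; apply: leq_trans le_xy.
  - apply/subsetP => a /setIP[]; rewrite !inE => /andP[/eqP Qa le_aj] le_ca.
    (* The box of column [c] in the row of [a] would belong to [X0 l j] and lie below [b], the
       lowest such box. *)
    have [b' [rb' cb']] := box_left le_ca.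
    rewrite leqNgt; apply/negP => lt_ba.
    have rb'a : brow b' = brow a by apply: val_inj.
    have [_ _ [_ [Qrow Qcol]] _ _] := pict.
    have Qb'a : (Q b' <= Q a)%N by apply: Qrow; rewrite ?cb'.
    have Qbb' : (Q b <= Q b')%N by apply: Qcol; rewrite ?cb' // rb' ltnW.
    have Qb' : Q b' = l by apply: val_inj; rewrite /=; move: Qb'a Qbb'; rewrite Qa Qb; lia.
    have /bmax : (b' \in X0 l j) && (bcol b' == c).
      rewrite !inE Qb' cb' !eqxx andbT /=; apply: leq_trans le_aj.
      by apply: picture_corner; rewrite ?Qb' ?Qa ?rb' ?cb'.
    by move=> /=; rewrite rb' leqNgt lt_ba.
  - apply/subsetP => a; rewrite !inE -ltnNge => /andP[lt_ca /andP[/eqP Qa le_ab]].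
    rewrite Qa eqxx /=; apply: leq_trans le_bj.
    by apply: picture_corner; rewrite ?Qb ?Qa // cb ltnW.
  move=> _ [|-> _ //].
  transitivity #|[set a in F l | ((brow (p a) <= brow b) && (brow (q (alpha a)) <= j))%N]|.
    by apply: eq_card => a; rewrite !inE andbAC -andbA.
  rewrite eq_counts ?ltn_ord //; apply: eq_card => a; rewrite !inE.
  by rewrite andbAC -andbA.
have eqX0 : X0 l j :&: [set a | (c <= bcol a)%N] = X0 l j :&: [set a | (c < bcol a)%N].
  apply/setP => a; rewrite !in_setI !inE; apply: andb_id2l => /= Xa.
  have := noc; rewrite negb_exists => /forallP/(_ a); rewrite !inE Xa /= => neq_c.
  by rewrite ltn_neqAle eq_sym neq_c.
rewrite eqX0 -IH; last by lia.
by apply/subset_leq_card/setIS/subsetP => a; rewrite !inE => /ltnW.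
Qed.

Lemma eq_counts_rigid : (forall a, q (alpha a) = alpha (p a)).
Proof.
have [[beta alphaK betaK] PalphaE [Pord Qord] [Srow Scol] adm] := pict.
have Pal a : P (alpha a) = Q a by apply: PalphaE.
have Qbe b : Q (beta b) = P b by rewrite -Pal betaK.
have cardE (K : {set box la}) : #|alpha @^-1: K| = #|K|.
  by apply: on_card_preimset; exists beta => b _; rewrite ?alphaK ?betaK.
(* Equality of counts triggers the rigid case of [col_upset_count] for the boxes of the fiber whose
   preimage is weakly right of that of [q b], so [b] is among them. Hence [q] never moves a preimage
   to the right, and being a permutation it preserves the columns of preimages. *)
have kappa_q b : bcol (beta (q b)) = bcol (beta b).
  pose cmax := (\max_(a : box mu) (bcol a))%N.
  pose h b' := (cmax - bcol (beta b'))%N.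
  have le_h b' : (bcol (beta b') <= cmax)%N.
    by apply: (leq_bigmax (F := fun a => bcol a)).
  suff : forall b', (h b' <= h (q b'))%N.
    move=> incr_h; have : h (q b) = h b by apply: perm_increasing_eq incr_h b.
    by move: (le_h b) (le_h (q b)); rewrite /h; lia.
  move=> {}b; suff : (bcol (beta (q b)) <= bcol (beta b))%N by rewrite /h; lia.
  pose K := [set b' | (P b' == P b) && (bcol (beta (q b)) <= bcol (beta b'))%N].
  have := @col_upset_count la q [set b' | P b' == P b] K qC.
  case=> [b'|||_ rig]; rewrite ?inE ?Pq //.
  - by apply/subsetP => b'; rewrite !inE => /andP[].
  - move=> b1 b2; rewrite !inE => /andP[/eqP Pb Gb] /eqP Pb' cb le_r.
    rewrite Pb' eqxx /=.
    move: le_r; rewrite leq_eqVlt => /predU1P[eq_r|lt_r].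
      by rewrite (box_inj (a := b2) (b := b1)).
    have [] := adm (beta b2) (beta b1); rewrite ?betaK ?Qbe ?Pb ?Pb' // => _.
    exact: leq_trans.
  - have := rig _ b; rewrite !inE Pq eqxx leqnn /=; apply=> // b' _.
    have := @eq_count_right_columns (P b) (brow (q b')) (bcol (beta (q b))) (ltn_ord _) => eq_c.
    rewrite -[LHS]cardE -[RHS]cardE.
    transitivity #|X (P b) (brow (q b')) :&: [set a | (bcol (beta (q b)) <= bcol a)%N]|.
      by apply: eq_card => a; rewrite !inE Pal alphaK andbAC.
    by rewrite eq_c; apply: eq_card => a; rewrite !inE Pal alphaK andbAC.
have inj_bqa : injective (fun a => beta (q (alpha a))).
  move=> a b /(can_inj betaK)/perm_inj; exact: (can_inj alphaK).
(* Conjugating [q] by [alpha] gives a column-preserving [p1] on [mu]; it remains to show that its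
   discrepancy [p2] from [p] is trivial. *)
pose p1 := perm inj_bqa.
have p1E a : p1 a = beta (q (alpha a)) by rewrite permE.
have p1C a : bcol (p1 a) = bcol a by rewrite p1E kappa_q alphaK.
have Qp1 a : Q (p1 a) = Q a by rewrite p1E Qbe Pq Pal.
have p1V_C a : bcol ((p1^-1)%g a) = bcol a by rewrite -p1C permKV.
have Qp1V a : Q ((p1^-1)%g a) = Q a by rewrite -Qp1 permKV.
pose p2 := (p1^-1 * p)%g.
have p2C : p2 \in col_stab mu.
  by rewrite inE; apply/forallP => a; rewrite permM (col_stabE _ pC) p1V_C.
have Qp2 a : Q (p2 a) = Q a by rewrite permM Qp Qp1V.
suff p2E : p2 = 1%g.
  move=> a; have <- : p1 = p by rewrite -(mulg1 p1) -p2E mulKVg.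
  by rewrite p1E betaK.
(* The boxes of a fiber with bounded row under [alpha] are up-closed, and the counts agree after
   substituting [p1], so [p2] preserves the row of the image under [alpha]. As this row increases
   strictly down the columns of a fiber, [p2] must be the identity. *)
have Sp2 a : brow (alpha (p2 a)) = brow (alpha a) :> nat.
  apply: (@perm_increasing_eq _ p2 (fun a => brow (alpha a)) _ a) => {}a.
  pose K := X0 (Q a) (brow (alpha (p2 a))).
  have := @col_upset_count mu p2 (F (Q a)) K p2C.
  case=> [b|||_ rig]; rewrite ?inE ?Qp2 //.
  - by apply/subsetP => b; rewrite !inE => /andP[].
  - move=> b1 b2; rewrite !inE => /andP[/eqP Q1 le_1] /eqP Q2 eq_c le_r.
    rewrite Q2 eqxx /=; apply: leq_trans le_1.
    by apply: picture_corner; rewrite ?Q1 ?Q2 ?eq_c.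
  - have := rig _ a; rewrite !inE Qp2 eqxx leqnn /=; apply=> // b _.
    have := @eq_counts (Q a) (brow (p2 b)) (brow (alpha (p2 a))) (ltn_ord _) (ltn_ord _).
    move=> eq_c.
    transitivity #|[set b0 in F (Q a) | ((brow (p b0) <= brow (p2 b)) &&
       (brow (q (alpha b0)) <= brow (alpha (p2 a))))%N]|.
      rewrite -[LHS](card_preimset _ (@perm_inj _ p1)); apply: eq_card => c.
      have p2p1 : p2 (p1 c) = p c by rewrite permM permK.
      by rewrite !inE p2p1 Qp1 p1E betaK -andbA [X in _ && X]andbC.
    by rewrite eq_c; apply: eq_card => c; rewrite !inE andbAC -andbA.
apply/permP => a; rewrite perm1; apply: box_inj; last by rewrite (col_stabE _ p2C).
case: (ltngtP (brow (p2 a)) (brow a)) => // lt_r; exfalso.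
  by have := Scol _ _ (Qp2 a) (col_stabE _ p2C) lt_r; rewrite Sp2 ltnn.
by have := Scol _ _ (esym (Qp2 a)) (esym (col_stabE _ p2C)) lt_r; rewrite Sp2 ltnn.
Qed.

End LeadingTerm.

(** Induction on a factorisation of [p] into transpositions, each carried along [f]. *)
Lemma odd_perm_conj (X Y : finType) (f : X -> Y) (p : {perm X}) (q : {perm Y}) :
  bijective f -> (forall x, q (f x) = f (p x)) -> odd_perm q = odd_perm p.
Proof.
move=> f_bij; have f_inj := bij_inj f_bij; have [g fK gK] := f_bij.
case: (prod_tpermP p) => ts -> _; elim: ts q => [|t ts IH] q qE.
  rewrite big_nil odd_perm1 (_ : q = 1%g) ?odd_perm1 //.
  by apply/permP => y; rewrite -[y]gK qE big_nil !perm1.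
rewrite big_cons odd_permM odd_tperm -(inj_eq f_inj) -odd_tperm.
rewrite -(IH (tperm (f t.1) (f t.2) * q)%g) ?odd_permM ?addKb // => x.
by rewrite permM -(inj_tperm _ _ _ f_inj) qE big_cons permM tpermK.
Qed.

(** * The weight of a variable and the top weight of a picture *)

Definition letter_weight (N m r s l i j : nat) : nat :=
  (N * ((m - l) * (r - i)) + N * ((m - l) * (s - j)) + (r - i) * (s - j))%N.

(** The two terms with factor [N] are governed by [column_rearrangement] on [mu] and on [la]. If one
    of them drops, it drops by at least [N], which exceeds the third sum. Otherwise [p] and [q]
    preserve the fibers, and the third sum is controlled by [fiber_count], with [eq_counts_rigid]
    for equality. *)
Lemma picture_weight (la mu : seq nat) (m r s N : nat) (P : box la -> 'I_m)
    (Q : box mu -> 'I_m) (alpha : box mu -> box la)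
    (p : {perm box mu}) (q : {perm box la}) :
    picture P Q alpha -> (size mu <= r)%N -> (size la <= s)%N ->
    (#|{: box mu}| * (r * s) < N)%N -> p \in col_stab mu -> q \in col_stab la ->
  (\sum_a letter_weight N m r s (Q a) (brow (p a)) (brow (q (alpha a))) <=
   \sum_a letter_weight N m r s (Q a) (brow a) (brow (alpha a)))%N /\
  ((\sum_a letter_weight N m r s (Q a) (brow (p a)) (brow (q (alpha a))) =
    \sum_a letter_weight N m r s (Q a) (brow a) (brow (alpha a)))%N ->
   (forall a, q (alpha a) = alpha (p a)) /\ (forall a, Q (p a) = Q a)).
Proof.
move=> pict le_r le_s ltN pC qC.
have [alpha_bij PalphaE [Pord Qord] _ _] := pict.
rewrite /letter_weight !big_split /= -!big_distrr /=.
have [] := @column_rearrangement mu p (fun a => Q a) m r pC le_r.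
- by move=> b; apply: ltn_ord.
- by case: Qord => _; apply.
have [] := @column_rearrangement la q (fun b => P b) m s qC le_s.
- by move=> b; apply: ltn_ord.
- by case: Pord => _; apply.
have S2E (f : box la -> nat) :
  (\sum_b (m - P b) * (s - f b) = \sum_a (m - Q a) * (s - f (alpha a)))%N.
  rewrite (reindex alpha) /=; last exact: onW_bij.
  by apply: eq_bigr => a _; rewrite -PalphaE.
rewrite (S2E (fun b => brow (q b))) (S2E (fun b => brow b)).
set S2 := (\sum_a _)%N; set S20 := (\sum_a _)%N => le2 rig2.
set S1 := (\sum_a _)%N; set S10 := (\sum_a _)%N => le1 rig1.
set S3 := (\sum_a _)%N; set S30 := (\sum_a _)%N.
have leS3 : (S3 < N)%N.
  apply: leq_ltn_trans ltN; rewrite -sum_nat_const.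
  by apply: leq_sum => a _; apply: leq_mul; apply: leq_subr.
have [eq1|ne1] := eqVneq S1 S10; last first.
  have {ne1} : (N * S1 + N <= N * S10)%N.
    by rewrite -mulnSr leq_mul2l ltn_neqAle ne1 le1 orbT.
  have : (N * S2 <= N * S20)%N by rewrite leq_mul2l le2 orbT.
  by move=> ? ?; split; lia.
have [eq2|ne2] := eqVneq S2 S20; last first.
  have {ne2} : (N * S2 + N <= N * S20)%N.
    by rewrite -mulnSr leq_mul2l ltn_neqAle ne2 le2 orbT.
  by rewrite eq1 => ?; split; lia.
have Qp a : Q (p a) = Q a by apply/val_inj/rig1.
have Pq b : P (q b) = P b by apply/val_inj/rig2.
rewrite eq1 eq2 leq_add2l.
have S3E (f g : box mu -> nat) : (\sum_a (r - f a) * (s - g a) =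
    \sum_(l : 'I_m) \sum_(i < r) \sum_(j < s)
      #|[set a in [set a | Q a == l] | (f a <= i) && (g a <= j)]|)%N.
  rewrite (partition_big Q predT) //=; apply: eq_bigr => l _.
  by rewrite -sum_mul_counts; apply: eq_bigl => a; rewrite inE.
rewrite /S3 /S30 (S3E (fun a => brow (p a)) (fun a => brow (q (alpha a)))).
rewrite (S3E (fun a => brow a) (fun a => brow (alpha a))).
have fc := fiber_count pict pC qC Qp Pq.
have fc1 (l : 'I_m) i := 
  @leq_sum _ (index_enum 'I_s) xpredT _ _ (fun (j : 'I_s) _ => fc l i j).
have fc2 (l : 'I_m) := 
  @leq_sum _ (index_enum 'I_r) xpredT _ _ (fun (i : 'I_r) _ => fc1 l i).
split; first by apply: leq_sum => l _; apply: fc2.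
move/addnI/(sum_leq_eq fc2) => eq_l; split=> //.
apply: (eq_counts_rigid pict pC qC Qp Pq) => l i j lt_i lt_j.
have /(_ (Ordinal (leq_trans lt_i le_r))) := sum_leq_eq (fun i' : 'I_r => fc1 l i') (eq_l l).
by move/(sum_leq_eq (fun j' : 'I_s => fc l _ j'))/(_ (Ordinal (leq_trans lt_j le_s))).
Qed.

(** * Row-sorted and semi-standard fillings *)

Lemma row_sorted_unique (mu : seq nat) (h h' : box mu -> nat) :
    (forall a b, brow a = brow b -> (bcol a <= bcol b)%N -> (h a <= h b)%N) ->
    (forall a b, brow a = brow b -> (bcol a <= bcol b)%N -> (h' a <= h' b)%N) ->
    (forall e d, #|[set a | (brow a == e) && (h a <= d)%N]| =
                 #|[set a | (brow a == e) && (h' a <= d)%N]|) ->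
  h =1 h'.
Proof.
have main (f f' : box mu -> nat) :
    (forall a b, brow a = brow b -> (bcol a <= bcol b)%N -> (f a <= f b)%N) ->
    (forall a b, brow a = brow b -> (bcol a <= bcol b)%N -> (f' a <= f' b)%N) ->
    (forall e d, #|[set a | (brow a == e) && (f a <= d)%N]| =
                 #|[set a | (brow a == e) && (f' a <= d)%N]|) ->
    forall a, (f' a <= f a)%N.
  move=> f_row f'_row eq_ff' a; rewrite leqNgt; apply/negP => lt_a.
  (* In the row of [a], boxes with [f' b <= f a] lie strictly left of [a] and so satisfy
     [f b <= f a]; the box [a] satisfies the latter without being among them. *)
  have /eqP := eq_ff' (brow a) (f a); rewrite eqn_leq => /andP[+ _]; apply/negP.
  rewrite -ltnNge; apply: proper_card; apply/properP; split.
    apply/subsetP => b; rewrite !inE => /andP[/eqP eb le_b]; rewrite eb eqxx /=.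
    apply: f_row => //; rewrite leqNgt; apply/negP => lt_ab.
    have := f'_row a b (esym eb) (ltnW lt_ab); rewrite leqNgt => /negP; apply.
    exact: leq_ltn_trans le_b lt_a.
  by exists a; rewrite !inE eqxx ?leqnn // -ltnNge.
move=> h_row h'_row eq_hh' a; apply/eqP; rewrite eqn_leq.
by rewrite !main // => e d; rewrite eq_hh'.
Qed.

Lemma sorted_leq_nth_count (t : seq nat) (c d : nat) : sorted leq t ->
  (c < size t)%N -> (nth 0 t c <= d)%N = (c < count (leq^~ d) t)%N.
Proof.
elim: t c => // x t IH c /=; rewrite path_sortedE; last exact: leq_trans.
case/andP=> /allP x_min t_sorted lt_c.
have [le_x|lt_x] := leqP x d.
  by case: c lt_c => [|c] lt_c /=; rewrite ?le_x // add1n ltnS IH.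
have -> : count (leq^~ d) t = 0%N.
  apply/eqP; rewrite -leqn0 leqNgt -has_count; apply/hasPn => y /x_min le_xy.
  by rewrite -ltnNge (leq_trans lt_x).
case: c lt_c => [|c] lt_c /=; first by rewrite leqNgt lt_x.
by apply/negbTE; rewrite -ltnNge (leq_trans lt_x) // x_min // mem_nth.
Qed.

(** Row [e] receives the letters with [rho = e], sorted by [key]. The entry in column [j] is then at
    most [d] exactly when more than [j] letters of the row have key at most [d], so the inequality
    between rows [e] and [e.+1] becomes strict increase down columns. *)
Lemma lattice_tableau (mu : seq nat) (T : finType) (rho key : T -> nat) :
    sorted geq mu ->
    (forall e, #|[set a | rho a == e]| = nth 0 mu e) ->
    (forall e c, #|[set a | (rho a == e.+1) && (key a <= c)%N]| <=
                 #|[set a | (rho a == e) && (key a < c)%N]|)%N ->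
  exists theta : box mu -> T,
    [/\ bijective theta, forall b, rho (theta b) = brow b,
        forall a b, brow a = brow b -> (bcol a <= bcol b)%N ->
          (key (theta a) <= key (theta b))%N &
        forall a b, bcol a = bcol b -> (brow a < brow b)%N ->
          (key (theta a) < key (theta b))%N].
Proof.
move=> mu_sorted card_rho lat.
(* The sorted lists below need a default letter [x0]; if [T] is empty, so is [box mu]. *)
case: (pickP (fun _ : T => true)) => [x0 _|T0]; last first.
  have boxF (b : box mu) : False.
    have := bcol_lt b; rewrite -card_rho (_ : [set _ | _] = set0) ?cards0 //.
    by apply/setP => a; have := T0 a.
  exists (fun b => False_rect T (boxF b)).
  split=> [|b|a|a]; try by [case: (boxF b) | case: (boxF a)].
  exists (fun x => False_rect _ (Bool.diff_true_false (T0 x))) => [b|x].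
    by case: (boxF b).
  by have := T0 x.
pose L e := sort (relpre key leq) (enum [set a | rho a == e]).
have L_sorted e : sorted leq (map key (L e)).
  by rewrite sorted_map; apply: sort_sorted => x y; apply: leq_total.
have size_L e : size (L e) = nth 0 mu e by rewrite size_sort -cardE card_rho.
have mem_L e x : (x \in L e) = (rho x == e) by rewrite mem_sort mem_enum inE.
have uniq_L e : uniq (L e) by rewrite sort_uniq enum_uniq.
have count_L e d : count (leq^~ d) (map key (L e)) =
    #|[set a | (rho a == e) && (key a <= d)%N]|.
  rewrite count_map -size_filter -(card_uniqP (filter_uniq _ (uniq_L e))).
  by apply: eq_card => a; rewrite mem_filter mem_L !inE andbC.
pose theta (b : box mu) := nth x0 (L (brow b)) (bcol b).
have lt_L (b : box mu) : (bcol b < size (L (brow b)))%N by rewrite size_L bcol_lt.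
have rhoE b : rho (theta b) = brow b by apply/eqP; rewrite -mem_L mem_nth.
have key_le (b : box mu) d : (key (theta b) <= d)%N =
    (bcol b < #|[set a | (rho a == brow b) && (key a <= d)%N]|)%N.
  rewrite -count_L -sorted_leq_nth_count ?size_map //.
  by rewrite (nth_map x0).
have theta_inj : injective theta.
  move=> a b eq_ab; have eq_r : brow a = brow b :> nat by rewrite -!rhoE eq_ab.
  apply: box_inj => //; apply/eqP; rewrite -(nth_uniq x0 _ _ (uniq_L (brow a))) //.
    by rewrite -/(theta a) eq_ab /theta eq_r.
  by rewrite eq_r.
exists theta; split=> // [|a b eq_r le_c|a b eq_c lt_r].
- apply: inj_card_bij => //; apply: leq_trans (leq_image_card theta predT).
  apply/subset_leq_card/subsetP => x _.
  have := index_mem x (L (rho x)); rewrite mem_L eqxx size_L => /box_exists[b [rb cb]].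
  apply/imageP; exists b => //; rewrite /theta rb cb nth_index //.
  by rewrite mem_L.
- rewrite key_le eq_r (leq_ltn_trans le_c) // -key_le //.
- have step (b1 b2 : box mu) : bcol b1 = bcol b2 -> brow b2 = (brow b1).+1 :> nat ->
      (key (theta b1) < key (theta b2))%N.
    move=> eq_c12 eq_r12; have := leqnn (key (theta b2)).
    rewrite key_le eq_r12 => lt_b2; have := leq_trans lt_b2 (lat _ _).
    case: (key (theta b2)) => [|d].
      rewrite (_ : [set _ | _] = set0) ?cards0 //.
      by apply/setP => x; rewrite !inE ltn0 andbF.
    by rewrite ltnS key_le eq_c12.
  have [n def_n] : exists n, brow b = (brow a + n.+1)%N :> nat.
    by exists (brow b - (brow a).+1)%N; lia.
  elim: n b eq_c def_n {lt_r} => [|n IH] b eq_c def_n.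
    by apply: step => //; rewrite def_n addn1.
  have [|b' [rb' cb']] := @box_above _ b (brow a + n.+1) mu_sorted.
    by rewrite def_n; lia.
  apply: (@ltn_trans (key (theta b'))); first by apply: IH; rewrite ?cb'.
  by apply: step; rewrite ?rb' // def_n; lia.
Qed.

(** * Garnir relations and leading monomials *)

Lemma natr_neq0 (R : idomainType) (n : nat) : [pchar R] =i pred0 -> (0 < n)%N ->
  n%:R != 0 :> R.
Proof. by move=> R0 n_gt0; rewrite (iffLR (pcharf0P R) R0) -lt0n. Qed.

Lemma natr_inj (R : idomainType) : [pchar R] =i pred0 ->
  injective (fun i : nat => i%:R : R).
Proof.
move=> R0 i j /eqP; wlog le_ij : i j / (i <= j)%N => [wl|].
  by case/orP: (leq_total i j) => /wl // wl'; rewrite eq_sym => /wl'.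
rewrite eq_sym -subr_eq0 -natrB // => eq0; apply/eqP; rewrite eqn_leq le_ij -subn_eq0.
by apply: contraTT eq0; rewrite -lt0n; apply: natr_neq0.
Qed.

(* The Garnir relations of a function on sets killed by the raising operator of
   sl_2: the members of [A] stay unraised, those of [B] stay raised. *)
Lemma garnir_relation (k : idomainType) (T : finType) (phi : {set T} -> k) (D : {set T}) :
    [pchar k] =i pred0 ->
    (forall Y : {set T}, Y \subset D -> \sum_(a in D :\: Y) phi (a |: Y) = 0) ->
  forall (j : nat) (A B : {set T}), A \subset D -> B \subset D ->
    [disjoint A & B] -> (#|A| < j)%N ->
  \sum_(Y : {set T} | (Y \subset D :\: (A :|: B)) && (#|Y| == j)) phi (B :|: Y) = 0.
Proof.
move=> k0 phi_E; elim=> // j IH A B sAD sBD dAB ltA.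
set Z := D :\: (A :|: B).
set Psi := LHS.
have ZP a : a \in Z -> [/\ a \in D, a \notin A & a \notin B].
  by rewrite !inE negb_or => /andP[/andP[-> ->] ->].
suff /eqP : Psi *+ j.+1 = 0.
  by rewrite -mulr_natr mulf_eq0 (negPf (natr_neq0 k0 _)) // orbF => /eqP.
pose PZ i (Y : {set T}) := (Y \subset Z) && (#|Y| == i).
(* Adding an element [a] of [A] gives an instance of the induction hypothesis, with [a] moved from
   [A] to [B]. *)
have sumA : \sum_(Y | PZ j Y) \sum_(a in A) phi (a |: (B :|: Y)) = 0.
  rewrite exchange_big big1 // => a Aa /=.
  have aB : a \notin B by rewrite (disjointFr dAB).
  have eqZ : D :\: ((A :\ a) :|: (a |: B)) = Z.
    by apply/setP => b; rewrite !inE; case: eqP => [->|//]; rewrite Aa.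
  rewrite -[RHS](IH (A :\ a) (a |: B)).
  - by rewrite eqZ; apply: eq_big => // Y _; rewrite setUA.
  - exact: subset_trans (subsetDl _ _) sAD.
  - by rewrite subUset sub1set (subsetP sAD).
  - rewrite disjoint_sym disjoints_subset; apply/subsetP => b; rewrite !inE negb_and negbK.
    case/predU1P=> [->|Bb]; first by rewrite eqxx.
    by rewrite (disjointFl dAB) ?orbT.
  - by move: ltA; rewrite (cardsD1 a A) Aa.
(* Each set of size [j.+1] arises from [j.+1] choices of the added element. *)
have sumZ : \sum_(Y | PZ j Y) \sum_(a in Z :\: Y) phi (a |: (B :|: Y)) = Psi *+ j.+1.
  rewrite (exchange_big_dep (mem Z)) /=; last by move=> Y a _ /setDP[].
  transitivity (\sum_(a in Z) \sum_(Y | PZ j.+1 Y && (a \in Y)) phi (B :|: Y)).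
    apply: eq_bigr => a Za.
    rewrite (reindex_onto (fun Y => Y :\ a) (fun Y => a |: Y)) /=; last first.
      by move=> Y /andP[_ /setDP[_ aY]]; rewrite setU1K.
    apply: eq_big => [Y|Y /andP[_ /eqP eqY]].
      rewrite /PZ in_setD in_setD1 Za eqxx /= andbT.
      apply/idP/idP => [/andP[/andP[sYZ /eqP cY] /eqP eqY]|/andP[/andP[sYZ /eqP cY] aY]].
        have aY : a \in Y by rewrite -eqY setU11.
        rewrite aY andbT (cardsD1 a Y) aY cY add1n eqxx andbT.
        by rewrite -(setD1K aY) subUset sub1set Za.
      rewrite (subset_trans (subsetDl _ _) sYZ) setD1K // eqxx andbT /=.
      by move: cY; rewrite (cardsD1 a Y) aY add1n => -[->].
    by rewrite setUCA eqY.
  rewrite (exchange_big_dep (PZ j.+1)) /=; last by move=> a Y _ /andP[].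
  rewrite -sumrMnl; apply: eq_bigr => Y /andP[sYZ /eqP cY].
  rewrite (eq_bigl (mem Y)) ?sumr_const ?cY // => a.
  rewrite /PZ sYZ cY eqxx /=; case Ya: (a \in Y); last by rewrite andbF.
  by rewrite (subsetP sYZ).
rewrite -sumZ -[LHS]add0r -{1}sumA -big_split /=.
rewrite big1 // => Y /andP[sYZ _].
rewrite -[RHS](phi_E (B :|: Y)); last first.
  by rewrite subUset sBD; apply: subset_trans sYZ (subsetDl _ _).
rewrite [RHS](bigID (mem A)) /=; congr (_ + _); apply: eq_bigl => a.
  rewrite !inE; case Aa: (a \in A); rewrite ?andbF // andbT (subsetP sAD) // andbT.
  rewrite (disjointFr dAB Aa) /=; apply/esym/negP => /(subsetP sYZ).
  by case/ZP; rewrite Aa.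
rewrite !inE; case: (a \in A); case: (a \in B); case: (a \in D); by rewrite ?andbF ?andbT.
Qed.

Definition word_mon (n : nat) (T : finType) (w : T -> 'I_n) : 'X_{1..n} :=
  (\sum_(a : T) U_(w a))%MM.

Lemma word_monE n (T : finType) (w : T -> 'I_n) v :
  word_mon w v = #|[set a | w a == v]|.
Proof.
rewrite mnm_sumE -sum1_card [RHS]big_mkcond; apply: eq_bigr => a _.
by rewrite mnm1E inE; case: eqP.
Qed.

Lemma eq_word_mon n (T : finType) (w w' : T -> 'I_n) :
  w =1 w' -> word_mon w = word_mon w'.
Proof. by move=> eq_w; apply: eq_bigr => a _; rewrite eq_w. Qed.

Lemma word_mon_sum n (T : finType) (w : T -> 'I_n) (g : 'I_n -> nat) :
  (\sum_v word_mon w v * g v = \sum_a g (w a))%N.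
Proof.
rewrite [RHS](partition_big w predT) //=; apply: eq_bigr => v _.
rewrite word_monE -sum1_card big_distrl /=; apply: eq_big => [a|a]; rewrite inE //.
by move/eqP->; rewrite mul1n.
Qed.

Definition mnm_fact (n : nat) (m : 'X_{1..n}) : nat := (\prod_i (m i)`!)%N.

Lemma mnm_factD1 n (m : 'X_{1..n}) v :
  mnm_fact (m + U_(v))%MM = ((m v).+1 * mnm_fact m)%N.
Proof.
rewrite /mnm_fact (bigD1 v) //= [in RHS](bigD1 v) //= mulnA mnmDE mnm1E eqxx addn1 factS.
congr (_ * _)%N; apply: eq_bigr => i ne_i.
by rewrite mnmDE mnm1E eq_sym (negPf ne_i) addn0.
Qed.

Lemma mnm_fact_gt0 n (m : 'X_{1..n}) : (0 < mnm_fact m)%N.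
Proof. by apply: prodn_gt0 => i; apply: fact_gt0. Qed.

Section Polarization.
Variables (k : fieldType) (n : nat) (f : {mpoly k[n]}) (T : finType).
Hypothesis k0 : [pchar k] =i pred0.

(* Up to a global factor, the full polarization of [f] at the word [w]. *)
Definition polar (w : T -> 'I_n) : k := f@_(word_mon w) * (mnm_fact (word_mon w))%:R.

Lemma polar_eq0 w : (polar w == 0) = (f@_(word_mon w) == 0).
Proof. by rewrite mulf_eq0 (negPf (natr_neq0 k0 (mnm_fact_gt0 _))) orbF. Qed.

(** The factorials in [polar] balance the exponents produced by differentiation against the number
    of positions carrying a given letter. The coefficient at [word_mon w] of the raising operator
    applied to [f] thus becomes a sum over replacements of a single letter. *)
Lemma polar_raise (x : pred 'I_n) (y : 'I_n -> 'I_n) (w : T -> 'I_n) :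
    (forall v, x v -> y v != v) ->
    \sum_(v | x v) 'X_v * f^`M(y v) = 0 ->
  \sum_(a | x (w a)) polar (fun b => if b == a then y (w a) else w b) = 0.
Proof.
move=> neq_y Ef; pose m := word_mon w.
transitivity (\sum_(v | x v) ('X_v * f^`M(y v))@_m * (mnm_fact m)%:R); last first.
  by rewrite -mulr_suml -(raddf_sum (mcoeff m)) Ef raddf0 mul0r.
rewrite (partition_big w x) //=; apply: eq_bigr => v xv.
pose m0 := (m - U_(v))%MM.
have monU a : w a = v -> (m = U_(v) + m0)%MM /\
    word_mon (fun b => if b == a then y (w a) else w b) = (m0 + U_(y v))%MM.
  move=> wa; have m_def : m = (U_(v) + \sum_(b | b != a) U_(w b))%MM.
    by rewrite /m /word_mon (bigD1 a) //= wa.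
  have m0_def : m0 = (\sum_(b | b != a) U_(w b))%MM.
    by rewrite /m0 m_def addmC addmK.
  split; first by rewrite m0_def.
  rewrite /word_mon (bigD1 a) //= eqxx wa addmC m0_def; congr (_ + _)%MM.
  by apply: eq_bigr => b /negPf->.
(* If [v] does not occur in [w], there is no position to replace, and a multiple of ['X_v] has no
   coefficient at [m]. *)
have [mv0|] := posnP (m v).
  rewrite big_pred0; last first.
    move=> a; apply/negbTE; rewrite negb_and orbC -implybE; apply/implyP => /eqP wa.
    have [m_def _] := monU a wa.
    by move: mv0; rewrite m_def mnmDE mnm1E eqxx.
  rewrite mulrC mcoeffMr big1 ?mulr0 // => -[/= m1 m2] /eqP m_def.
  rewrite mcoeffX; case: eqP => [m1_def|]; last by rewrite mul0r.
  have := congr1 (fun m' : 'X_{1..n} => m' v) m_def.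
  by rewrite /= mv0 -m1_def mnmDE mnm1E eqxx; lia.
move=> mv; have [a0 /eqP wa0] : exists a, w a == v.
  move: mv; rewrite word_monE => /card_gt0P[a]; rewrite inE => ?; by exists a.
have [m_def _] := monU a0 wa0.
have -> : ('X_v * f^`M(y v))@_m = f@_(m0 + U_(y v)) *+ (m0 (y v)).+1.
  by rewrite {1}m_def mulrC mcoeffMX mcoeff_deriv.
transitivity (\sum_(a | w a == v)
    f@_(m0 + U_(y v)) * (mnm_fact (m0 + U_(y v))%MM)%:R).
  apply: eq_big => [a|a /andP[_ /eqP wa]].
    by rewrite andb_idl // => /eqP->.
  by rewrite /polar; case: (monU a wa) => _ ->.
have m_defC : m = (m0 + U_(v))%MM by rewrite addmC.
rewrite sumr_const -cardsE -word_monE -/m m_defC !mnm_factD1.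
rewrite mnmDE mnm1E eqxx addn1 !natrM.
rewrite -[f@__ *+ _]mulr_natr -[LHS]mulr_natr -!mulrA; do 2!congr (_ * _).
by rewrite mulrC.
Qed.
End Polarization.

Section LeadingMonomials.
Variables (k : fieldType) (n : nat) (f : {mpoly k[n]}) (T : finType) (w : T -> 'I_n).
Hypothesis k0 : [pchar k] =i pred0.
Variables (isx isy : pred 'I_n) (tau : 'I_n -> 'I_n) (col wt : 'I_n -> nat) (K : nat).
Hypothesis tau_y : forall v, isx v -> isy (tau v).
Hypothesis tau_x : forall v, isy v -> isx (tau v).
Hypothesis tauK : forall v, isx v || isy v -> tau (tau v) = v.
Hypothesis xy_disjoint : forall v, isx v -> ~~ isy v.
Hypothesis col_tau : forall v, isx v -> col (tau v) = col v.
Hypothesis col_inj : forall u v, isx u -> isx v -> col u = col v -> u = v.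
Hypothesis wt_tau : forall v, isx v -> (wt v + col v = wt (tau v) + K)%N.
Hypothesis Ef : \sum_(v | isx v) 'X_v * f^`M(tau v) = 0.
Hypothesis f_w : f@_(word_mon w) != 0.
Hypothesis w_max : forall w' : T -> 'I_n, f@_(word_mon w') != 0 ->
  (\sum_a wt (w' a) <= \sum_a wt (w a))%N.

Let D := [set a | isx (w a) || isy (w a)].
(** For [Y] inside [D], this word has y-letters at the positions of [Y] and x-letters at the other
    positions of [D]; [w] itself is [wY] of its set of y-positions. *)
Let wY (Y : {set T}) a :=
  if a \in Y then (if isx (w a) then tau (w a) else w a)
  else (if isy (w a) then tau (w a) else w a).
Let lo a := if isy (w a) then tau (w a) else w a.

Let isy_x v : isy v -> isx v = false.
Proof. by move=> yv; apply/negP => /xy_disjoint; rewrite yv. Qed.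

Let isx_wY (Y : {set T}) a : Y \subset D -> isx (wY Y a) = (a \in D :\: Y).
Proof.
move=> sYD; rewrite !inE /wY; have [Ya|nYa] := boolP (a \in Y) => /=.
  have := subsetP sYD _ Ya; rewrite inE; case: ifP => [xa _|-> //].
  by rewrite isy_x ?tau_y.
by case: ifP => [ya|_]; rewrite ?tau_x ?orbT ?orbF.
Qed.

Let polar_wY (Y : {set T}) : Y \subset D ->
  \sum_(a in D :\: Y) polar f (wY (a |: Y)) = 0.
Proof.
move=> sYD; have neq_tau v : isx v -> tau v != v.
  by move=> xv; apply/eqP => eq_v; have := xy_disjoint xv; rewrite -{1}eq_v tau_y.
rewrite -[RHS](polar_raise (wY Y) neq_tau Ef).
apply: eq_big => [a|a]; first by rewrite isx_wY.
rewrite inE => /andP[nYa]; rewrite inE => Da; rewrite /polar.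
suff /eq_word_mon -> : wY (a |: Y) =1 fun b => if b == a then tau (wY Y a) else wY Y b.
  by [].
move=> b; rewrite /wY in_setU1; case: (eqVneq b a) => [->|//] /=.
rewrite (negPf nYa); case/orP: Da => [xa|ya].
  by rewrite xa (negPf (xy_disjoint xa)).
by rewrite isy_x // ya tauK ?ya ?orbT.
Qed.

(** For a fixed size of [Y], the weight of [wY Y] grows with the [col] values at the positions of
    [Y]. *)
Let wt_wY (Y : {set T}) : Y \subset D ->
  (\sum_a wt (wY Y a) + K * #|Y| = \sum_a wt (lo a) + \sum_(a in Y) col (w a))%N.
Proof.
move=> sYD; rewrite (mulnC K) -sum_nat_const [X in (_ + X = _)%N]big_mkcond.
rewrite [X in (_ = _ + X)%N]big_mkcond -!big_split; apply: eq_bigr => a _; rewrite /wY /lo /=.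
case: ifP => Ya; last by rewrite !addn0.
have := subsetP sYD a Ya; rewrite inE => /orP[xa|ya].
  by rewrite xa (negPf (xy_disjoint xa)) wt_tau.
have xa := tau_x ya.
have tauwa : tau (tau (w a)) = w a by rewrite tauK // ya orbT.
by have := wt_tau xa; have := col_tau xa; rewrite tauwa isy_x // ya => -> ->.
Qed.

(** Otherwise the Garnir relation for [A] (x-positions with [col < c]), [B] (y-positions with
    [col > c]) and size [#|Y0|] writes zero as a sum over ways of trading y-positions with
    [col <= c] for x-positions with [col >= c]. No trade lowers the weight, so by maximality only
    trades inside [col = c] survive. These leave the monomial unchanged, and the sum is a positive
    multiple of [polar f w]. *)
Lemma leading_monomial_lattice c :
  (#|[set a | isy (w a) && (col (w a) <= c)]| <=
   #|[set a | isx (w a) && (col (w a) < c)]|)%N.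
Proof.
set Y0 := [set a | _]; set A := [set a | _].
rewrite leqNgt; apply/negP => ltAY.
pose B := [set a | isy (w a) && (c < col (w a))%N].
have sAD : A \subset D by apply/subsetP => a; rewrite !inE => /andP[->].
have sBD : B \subset D by apply/subsetP => a; rewrite !inE => /andP[->]; rewrite orbT.
have dAB : [disjoint A & B].
  rewrite disjoints_subset; apply/subsetP => a; rewrite !inE => /andP[xa _].
  by rewrite (negPf (xy_disjoint xa)).
have := garnir_relation (phi := fun Y => polar f (wY Y)) k0 polar_wY sAD sBD dAB ltAY.
set Z := D :\: _.
have ZxP a : a \in Z -> a \notin Y0 -> isx (w a) && (c <= col (w a))%N.
  rewrite !inE; case xa: (isx (w a)); last first.
    by case: (isy (w a)) => //=; rewrite andbT -leqNgt => ->.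
  by rewrite (negPf (xy_disjoint xa)) /= orbF -leqNgt => /andP[].
have sY0Z : Y0 \subset Z.
  apply/subsetP => a; rewrite !inE => /andP[ya le_c].
  by rewrite isy_x // ya /= -leqNgt le_c.
have dBZ (Y : {set T}) : Y \subset Z -> #|B :|: Y| = (#|B| + #|Y|)%N.
  move=> sYZ; rewrite cardsU (_ : B :&: Y = set0) ?cards0 ?subn0 //.
  apply/setP => a; rewrite in_setI in_set0; apply/negP => /andP[Ba /(subsetP sYZ)].
  by rewrite in_setD in_setU Ba orbT.
have wE : wY (B :|: Y0) =1 w.
  move=> a; rewrite /wY !inE -andb_orr.
  have -> : (c < col (w a))%N || (col (w a) <= c)%N by rewrite orbC; case: leqP.
  by rewrite andbT; case ya: (isy (w a)); rewrite ?isy_x.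
have sBYD (Y : {set T}) : Y \subset Z -> B :|: Y \subset D.
  by move=> sYZ; rewrite subUset sBD; apply: subset_trans sYZ (subsetDl _ _).
have key (Y : {set T}) : Y \subset Z -> #|Y| = #|Y0| ->
    polar f (wY (B :|: Y)) != 0 -> word_mon (wY (B :|: Y)) = word_mon w.
  move=> sYZ cY; rewrite polar_eq0 // => /w_max le_wt.
  have {le_wt} : (\sum_(a in Y) col (w a) <= \sum_(a in Y0) col (w a))%N.
    have := wt_wY (sBYD _ sYZ); have := wt_wY (sBYD _ sY0Z).
    rewrite (eq_bigr (fun a => wt (w a))) => [|a _]; last by rewrite wE.
    rewrite !dBZ // cY.
    have big_BU (Y' : {set T}) : Y' \subset Z -> (\sum_(a in B :|: Y') col (w a) =
       \sum_(a in B) col (w a) + \sum_(a in Y') col (w a))%N.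
      move=> sY'Z; rewrite -bigU /=; first by apply: eq_bigl => a; rewrite !inE.
      rewrite disjoints_subset; apply/subsetP => a Ba; rewrite inE.
      by apply/negP => /(subsetP sY'Z); rewrite in_setD in_setU Ba orbT.
    by rewrite !big_BU //; lia.
  rewrite (big_setID Y0) [X in (_ <= X)%N](big_setID Y) /= setIC leq_add2l => le_col.
  have cD : #|Y :\: Y0| = #|Y0 :\: Y|.
    by move: cY; rewrite -(cardsID Y0 Y) -(cardsID Y Y0) setIC => /addnI.
  have geY a : a \in Y :\: Y0 -> isx (w a) && (c <= col (w a))%N.
    by case/setDP => /(subsetP sYZ); apply: ZxP.
  have leY0 a : a \in Y0 :\: Y -> isy (w a) && (col (w a) <= c)%N.
    by case/setDP => /[!inE].
  have ge_sum : (\sum_(a in Y :\: Y0) c <= \sum_(a in Y :\: Y0) col (w a))%N.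
    by apply: leq_sum => a /geY/andP[].
  have le_sum : (\sum_(a in Y0 :\: Y) col (w a) <= \sum_(a in Y0 :\: Y) c)%N.
    by apply: leq_sum => a /leY0/andP[].
  have eqc : (\sum_(a in Y :\: Y0) c = \sum_(a in Y0 :\: Y) c)%N.
    by rewrite !sum_nat_const cD.
  have colY a : a \in Y :\: Y0 -> col (w a) = c.
    have /sum_leq_eq H : forall a, ((if a \in Y :\: Y0 then c else 0) <=
                               (if a \in Y :\: Y0 then col (w a) else 0))%N.
      by move=> b; case: ifP => // /geY/andP[].
    move=> aY; have /H/(_ a) : (\sum_a (if a \in Y :\: Y0 then c else 0) =
        \sum_a (if a \in Y :\: Y0 then col (w a) else 0))%N.
      by rewrite -!big_mkcond /=; lia.
    by rewrite aY.
  have colY0 a : a \in Y0 :\: Y -> col (w a) = c.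
    have /sum_leq_eq H : forall a, ((if a \in Y0 :\: Y then col (w a) else 0) <=
                               (if a \in Y0 :\: Y then c else 0))%N.
      by move=> b; case: ifP => // /leY0/andP[].
    move=> aY; have /H/(_ a) : (\sum_a (if a \in Y0 :\: Y then col (w a) else 0) =
        \sum_a (if a \in Y0 :\: Y then c else 0))%N.
      by rewrite -!big_mkcond /=; lia.
    by rewrite aY.
  have split_mon (v : T -> 'I_n) : word_mon v = (\sum_(a in Y :\: Y0) U_(v a) +
       (\sum_(a in Y0 :\: Y) U_(v a) +
        \sum_(a | (a \notin Y :\: Y0) && (a \notin Y0 :\: Y)) U_(v a)))%MM.
    rewrite /word_mon (bigID (mem (Y :\: Y0))) /=; congr (_ + _)%MM.
    rewrite (bigID (mem (Y0 :\: Y))) /=; congr (_ + _)%MM; apply: eq_bigl => a.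
    by rewrite !inE; case: (a \in Y); rewrite ?andbF ?andbT //= andbT andbC.
  rewrite !split_mon !addmA; congr (_ + _)%MM; last first.
    apply: eq_bigr => a Ya; congr U_(_)%MM; rewrite -[RHS]wE /wY !in_setU.
    suff -> : (a \in Y) = (a \in Y0) by [].
    by move: Ya; rewrite !in_setD; case: (a \in Y); case: (a \in Y0).
  (* All traded x-positions carry the single x-letter with [col = c], all traded y-positions carry
     its image under [tau], and there are equally many of each; the trade only exchanges the two
     blocks. *)
  have [Y0D|[x0 x0D]] := set_0Vmem (Y :\: Y0).
    have Y0D' : Y0 :\: Y = set0 by apply/eqP; rewrite -cards_eq0 -cD Y0D cards0.
    by rewrite Y0D Y0D' !big_set0.
  have /andP[xx0 _] := geY _ x0D.
  have wx a : a \in Y :\: Y0 -> w a = w x0.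
    by move=> aD; have /andP[xa _] := geY _ aD; apply: col_inj; rewrite ?colY.
  have wy a : a \in Y0 :\: Y -> w a = tau (w x0).
    move=> aD; have /andP[ya _] := leY0 _ aD.
    rewrite -(tauK (v := w a)) ?ya ?orbT //; congr tau.
    apply: col_inj => //; first exact: tau_x.
    by rewrite -(col_tau (tau_x ya)) tauK ?ya ?orbT // (colY x0) ?(colY0 a).
  have sx : (\sum_(a in Y :\: Y0) U_(w a) = \sum_(a in Y0 :\: Y) U_(wY (B :|: Y) a))%MM.
    rewrite (eq_bigr (fun=> U_(w x0)%MM)) => [|a /wx-> //].
    rewrite [RHS](eq_bigr (fun=> U_(w x0)%MM)) => [|a aD].
      by rewrite !big_const cD.
    have /andP[ya le_a] := leY0 _ aD; have /setDP[_ nYa] := aD.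
    rewrite /wY !inE ya ltnNge le_a (negPf nYa) /= wy // tauK ?xx0 //.
  have sy : (\sum_(a in Y0 :\: Y) U_(w a) = \sum_(a in Y :\: Y0) U_(wY (B :|: Y) a))%MM.
    rewrite (eq_bigr (fun=> U_(tau (w x0))%MM)) => [|a /wy-> //].
    rewrite [RHS](eq_bigr (fun=> U_(tau (w x0))%MM)) => [|a aD].
      by rewrite !big_const cD.
    have /setDP[Ya _] := aD.
    by rewrite /wY !inE Ya orbT wx // xx0.
  by rewrite sx sy addmC.
pose PY (Y : {set T}) := (Y \subset Z) && (#|Y| == #|Y0|).
(* The nonzero terms all equal [polar f w], and [Y0] gives one of them, so their number is nonzero
   in [k]. *)
rewrite (bigID (fun Y => polar f (wY (B :|: Y)) != 0)) /= [X in _ + X]big1 ?addr0; last first.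
  by move=> Y /andP[_]; rewrite negbK => /eqP.
rewrite (eq_bigr (fun=> polar f w)) => [|Y /andP[/andP[sYZ /eqP cY] nz]]; last first.
  by rewrite /polar key.
rewrite sumr_const -mulr_natr => /eqP; rewrite mulf_eq0 polar_eq0 // (negPf f_w) /=.
apply/negP/natr_neq0 => //; apply/card_gt0P; exists Y0.
rewrite unfold_in /= sY0Z eqxx /= polar_eq0 //.
by rewrite (eq_word_mon wE).
Qed.

End LeadingMonomials.

(** * Polynomial functions in characteristic zero *)

Section Evaluation.
Variables (k : fieldType) (n : nat).
Hypothesis k0 : [pchar k] =i pred0.
Implicit Types (f g : {mpoly k[n]}) (u v : 'I_n -> k).

Lemma poly_horner_eq0 (p : {poly k}) : (forall t, p.[t] = 0) -> p = 0.
Proof.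
move=> p0; apply/eqP; apply: contraT => nz_p.
have := max_poly_roots nz_p (rs := [seq i%:R | i <- iota 0 (size p)]).
rewrite size_map size_iota ltnn => -> //.
  by apply/allP => _ /mapP[i _ ->]; apply/eqP/p0.
by rewrite map_inj_uniq ?iota_uniq //; apply: natr_inj.
Qed.

(** The restriction of [f] to the line through [v] with direction [u], as a polynomial in the
    parameter of the line. *)
Let path u v f : {poly k} := mmap polyC (fun i => (v i)%:P + u i *: 'X) f.

Let pathM u v f g : path u v (f * g) = path u v f * path u v g.
Proof. exact: rmorphM. Qed.

Let pathE u v f t : (path u v f).[t] = f.@[fun i => v i + t * u i].
Proof.
rewrite /path /mmap mevalE horner_sum; apply: eq_bigr => m _.
rewrite hornerM hornerC /mmap1 horner_prod; congr (_ * _); apply: eq_bigr => i _.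
by rewrite horner_exp hornerD hornerC hornerZ hornerX mulrC.
Qed.

Let path_deriv u v f : (path u v f)^`().[0] = \sum_i u i * (f^`M(i)).@[v].
Proof.
pose P f := (path u v f)^`().[0] = \sum_i u i * (f^`M(i)).@[v].
have P1 : P 1.
  rewrite /P /path rmorph1 derivC horner0 big1 // => i _.
  by rewrite -mpolyC1 mderivC meval0 mulr0.
have PM g h : P g -> P h -> P (g * h).
  move=> Pg Ph; rewrite /P pathM derivM hornerD !hornerM Pg Ph !pathE.
  rewrite mulr_suml mulr_sumr -big_split; apply: eq_bigr => i _ /=.
  rewrite mderivM mevalD !mevalM mulrDr.
  have e0 (e : {mpoly k[n]}) : e.@[fun j => v j + 0 * u j] = e.@[v].
    by apply: meval_eq => j; rewrite mul0r addr0.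
  by rewrite !e0 -mulrA [g.@[v] * _]mulrCA.
have PX j : P 'X_j.
  rewrite /P /path mmapX mmap1U derivD derivC add0r derivZ derivX hornerZ hornerC mulr1.
  rewrite (bigD1 j) //= big1 ?addr0 => [|i ne_i].
    by rewrite mderivX mnm1E eqxx scale1r -{1}[U_(j)%MM]add0m addmK mpolyX0 meval1 mulr1.
  by rewrite mderivX mnm1E eq_sym (negPf ne_i) scale0r meval0 mulr0.
have PXm m : P 'X_[m].
  rewrite mpolyXE_id; apply: (big_ind P) => // i _.
  by elim: (m i) => [|e IH]; rewrite ?expr0 ?exprS //; apply: PM.
rewrite -/(P f); elim/mpolyind: f => [|c m g _ _ Pg].
  rewrite /P /path raddf0 deriv0 horner0 big1 // => i _.
  by rewrite mderiv0 meval0 mulr0.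
rewrite /P /path mmapD mmapZ derivD hornerD Pg derivM derivC mul0r add0r hornerM hornerC.
rewrite PXm mulr_sumr -big_split; apply: eq_bigr => i _ /=.
by rewrite mderivD mderivZ mevalD mevalZ mulrDr mulrCA.
Qed.

Lemma deriv_along_line f u v c :
  (forall t, f.@[fun i => v i + t * u i] = c) -> \sum_i u i * (f^`M(i)).@[v] = 0.
Proof.
move=> fc; rewrite -path_deriv; suff -> : path u v f = c%:P by rewrite derivC horner0.
apply/eqP; rewrite -subr_eq0; apply/eqP/poly_horner_eq0 => t.
by rewrite hornerD hornerN hornerC pathE fc subrr.
Qed.

(** All iterated derivatives vanish as functions too. The value at the origin of the one with
    multi-index [m] is the coefficient at [m] times a product of factorials, nonzero in
    characteristic zero. *)
Lemma meval_eq0 f : (forall v, f.@[v] = 0) -> f = 0.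
Proof.
move=> f0; apply/mpolyP => m; rewrite mcoeff0.
have derv_eq0 : forall g i, (forall v, g.@[v] = 0) -> forall v, (g^`M(i)).@[v] = 0.
  move=> g i g0 v; have := @deriv_along_line g (fun j => (j == i)%:R) v 0.
  rewrite (bigD1 i) //= eqxx mul1r big1 ?addr0 => [-> //|j /negPf->]; last by rewrite mul0r.
have {f0} fm0 v : (f^`M[m]).@[v] = 0.
  move: f0 v; rewrite mderivm_foldr; elim: (flatten _) f => //= i s IH g g0 v.
  by apply: derv_eq0 => v'; apply: IH.
have := fm0 (fun=> 0); rewrite mevalE => sum0.
have : (f^`M[m])@_0 = 0.
  have [in0|] := boolP (0%MM \in msupp f^`M[m]); last by rewrite -mcoeff_eq0 => /eqP.
  rewrite -[RHS]sum0 (bigD1_seq 0%MM) ?msupp_uniq //= big1 => [|i _].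
    rewrite mulr1 big1 ?addr0 // => m' nz_m'; apply/eqP; rewrite mulf_eq0; apply/orP; right.
    have [i mi] : exists i, m' i != 0%N.
      apply/existsP; apply: contraR nz_m' => /existsPn m0; apply/eqP/mnmP => i.
      by rewrite mnm0E; apply/eqP; rewrite -[_ == _]negbK m0.
    by rewrite (bigD1 i) //= expr0n (negPf mi) mul0r.
  by rewrite mnm0E expr0.
rewrite mcoeff_mderivm addm0 => /eqP; rewrite -mulr_natr mulf_eq0.
case/orP => [/eqP //|]; apply: contraTeq => _; apply: natr_neq0 => //.
by apply: prodn_gt0 => i; rewrite ?mnmDE ?mnm0E ?addn0 ffactnn fact_gt0.
Qed.

(** Differentiate the invariance at [t = 0]: the tangent direction at [v] has [v (tau i)] in the
    y-coordinates, and reindexing by [tau] gives the raising operator. *)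
Lemma raising_eq0 f (isx isy : pred 'I_n) (tau : 'I_n -> 'I_n) :
    (forall i, isx i -> isy (tau i)) -> (forall i, isy i -> isx (tau i)) ->
    involutive tau ->
    (forall v t, f.@[fun i => v i + t * (if isy i then v (tau i) else 0)] = f.@[v]) ->
  \sum_(i | isx i) 'X_i * f^`M(tau i) = 0.
Proof.
move=> tau_y tau_x tauK f_inv; apply: meval_eq0 => v.
rewrite raddf_sum /= -[RHS](deriv_along_line (f_inv v)).
rewrite (reindex_inj (inv_inj tauK)) [RHS](bigID isy) /= [X in _ = _ + X]big1 ?addr0.
  apply: eq_big => [i|i]; last first.
    by rewrite tauK mevalM mevalXU => /tau_y; rewrite tauK => ->.
  by apply/idP/idP => [/tau_y|/tau_x//]; rewrite tauK.
by move=> i /negPf->; rewrite mul0r.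
Qed.

(** The substitution multiplies the coefficient at [m] by [\prod_i d i ^+ m i], and by [meval_eq0]
    the coefficients are determined by the values. *)
Lemma msupp_scaling f (d : 'I_n -> k) (c : k) :
    (forall v, f.@[fun i => d i * v i] = c * f.@[v]) ->
  forall m, m \in msupp f -> \prod_i d i ^+ m i = c.
Proof.
move=> f_scale m fm; pose g := \sum_(m' <- msupp f) (f@_m' * \prod_i d i ^+ m' i) *: 'X_[m'].
have : g - c *: f = 0.
  apply: meval_eq0 => v; rewrite mevalB mevalZ -f_scale /g raddf_sum /= mevalE.
  apply/eqP; rewrite subr_eq0; apply/eqP; apply: eq_bigr => m' _.
  rewrite mevalZ mevalX -mulrA -big_split; congr (_ * _); apply: eq_bigr => i _.
  by rewrite exprMn.
move/(congr1 (mcoeff m)); rewrite mcoeffB mcoeffZ mcoeff0 /g raddf_sum /=.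
rewrite (bigD1_seq m) ?msupp_uniq //= [X in _ + X - _]big1 => [|m' ne_m']; last first.
  by rewrite mcoeffZ mcoeffX (negPf ne_m') mulr0.
rewrite mcoeffZ mcoeffX eqxx mulr1 addr0 mulrC -mulrBl => /eqP.
by rewrite mulf_eq0 -[f@_m == 0]negbK -mcoeff_msupp fm orbF subr_eq0 => /eqP.
Qed.

End Evaluation.

(** * Highest weight vectors *)

Section Letters.
Variables (m r s : nat).
Let L := {: 'I_m * 'I_r * 'I_s}.
Definition letter_level (v : 'I_#|L|) : 'I_m := (enum_val v).1.1.
Definition letter_row (v : 'I_#|L|) : 'I_r := (enum_val v).1.2.
Definition letter_col (v : 'I_#|L|) : 'I_s := (enum_val v).2.

Lemma letter_rankE (v : 'I_#|L|) :
  enum_rank (letter_level v, letter_row v, letter_col v) = v.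
Proof.
apply: (can_inj enum_valK); rewrite enum_rankK /letter_level /letter_row /letter_col.
by case: (enum_val v) => -[].
Qed.

Lemma letter_levelK l i j : letter_level (enum_rank (l, i, j)) = l.
Proof. by rewrite /letter_level enum_rankK. Qed.

Lemma letter_rowK l i j : letter_row (enum_rank (l, i, j)) = i.
Proof. by rewrite /letter_row enum_rankK. Qed.

Lemma letter_colK l i j : letter_col (enum_rank (l, i, j)) = j.
Proof. by rewrite /letter_col enum_rankK. Qed.

(** The matrix row is reversed to match the row index of [mu] in [u_elt]. *)
Definition weight_of_letter (N : nat) (v : 'I_#|L|) : nat :=
  letter_weight N m r s (letter_level v) (rev_ord (letter_row v)) (letter_col v).

Definition swap_rows (i0 i1 : 'I_r) (v : 'I_#|L|) : 'I_#|L| :=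
  enum_rank (letter_level v, tperm i0 i1 (letter_row v), letter_col v).

Definition swap_cols (j0 j1 : 'I_s) (v : 'I_#|L|) : 'I_#|L| :=
  enum_rank (letter_level v, letter_row v, tperm j0 j1 (letter_col v)).

Definition letterE := (letter_levelK, letter_rowK, letter_colK).

Lemma swap_rowsK i0 i1 : involutive (swap_rows i0 i1).
Proof. by move=> v; rewrite {1}/swap_rows !letterE tpermK letter_rankE. Qed.

Lemma swap_colsK j0 j1 : involutive (swap_cols j0 j1).
Proof. by move=> v; rewrite {1}/swap_cols !letterE tpermK letter_rankE. Qed.
End Letters.

(** * Consequences of unipotent invariance and of the torus weight *)

Section HighestWeight.
Variables (k : fieldType) (m r s : nat).
Hypothesis k0 : [pchar k] =i pred0.
Local Notation kMat := (coord_ring k m r s).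
Implicit Types (f : kMat) (A : 'I_m -> 'M[k]_(r, s)).

Lemma evalMatE f A :
  evalMat f A = f.@[fun v => A (letter_level v) (letter_row v) (letter_col v)].
Proof.
apply: meval_eq => v; rewrite /letter_level /letter_row /letter_col.
by case: (enum_val v) => -[].
Qed.

Lemma eq_evalMat f A A' : A =1 A' -> evalMat f A = evalMat f A'.
Proof. by move=> eqA; rewrite !evalMatE; apply: meval_eq => v; rewrite eqA. Qed.

Definition mat_of (v : 'I_#|{: 'I_m * 'I_r * 'I_s}| -> k) (l : 'I_m) : 'M[k]_(r, s) :=
  \matrix_(i, j) v (enum_rank (l, i, j)).

Lemma evalMat_of f v : evalMat f (mat_of v) = f.@[v].
Proof. by rewrite evalMatE; apply: meval_eq => x; rewrite mxE letter_rankE. Qed.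

Lemma upper_unitriangular_unit p (R : 'M[k]_p) :
  upper_unitriangular R -> R \in unitmx.
Proof.
case/andP=> R_trig /forallP R1; rewrite -unitmx_tr unitmxE det_trig //.
by rewrite big1 ?unitr1 // => i _; rewrite mxE; apply/eqP.
Qed.

Lemma upper_unitriangular1 p : upper_unitriangular (1%:M : 'M[k]_p).
Proof.
rewrite /upper_unitriangular trmx1 scalar_mx_is_trig.
by apply/forallP => i; rewrite mxE eqxx.
Qed.

Lemma upper_unitriangular_elem p (i j : 'I_p) (t : k) : (i < j)%N ->
  upper_unitriangular (1%:M + t *: delta_mx i j).
Proof.
move=> lt_ij; apply/andP; split.
  apply/is_trig_mxP => a b lt_ab; rewrite !mxE.
  rewrite -(val_eqE b a) gtn_eqF // add0r; case: eqP => [eb|_] /=; last by rewrite mulr0.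
  case: eqP => [ea|_]; last by rewrite mulr0.
  by move: lt_ij; rewrite -eb -ea ltnNge ltnW.
apply/forallP => a; rewrite !mxE eqxx.
suff -> : (a == i) && (a == j) = false by rewrite mulr0 addr0.
by apply: contraTF lt_ij => /andP[/eqP<- /eqP<-]; rewrite ltnn.
Qed.

Section Invariant.
Variables (f : kMat) (chi : 'I_r -> int) (psi : 'I_s -> int).
Hypothesis hw : highest_weight_space chi psi f.

Lemma hw_mull R A : upper_unitriangular R ->
  evalMat f (fun l => R *m A l) = evalMat f A.
Proof.
move=> upR; have [/(_ R 1%:M upR (upper_unitriangular1 s)) <- _] := hw.
apply: eq_evalMat => l.
by rewrite /actMat !invmx1 mulmx1 mulKmx // upper_unitriangular_unit.
Qed.

Lemma hw_mulr S A : upper_unitriangular S ->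
  evalMat f (fun l => A l *m S) = evalMat f A.
Proof.
move=> upS; have [/(_ 1%:M S (upper_unitriangular1 r) upS A) <- _] := hw.
by apply: eq_evalMat => l; rewrite /actMat invmx1 mul1mx invmxK.
Qed.

(** An elementary unipotent matrix acting on the left adds [t] times row [i1] to row [i0];
    [raising_eq0] differentiates this. *)
Lemma hw_raise_rows (i0 i1 : 'I_r) : (i0 < i1)%N ->
  \sum_(v | letter_row v == i1) 'X_v * f^`M(swap_rows i0 i1 v) = 0.
Proof.
move=> lt_i; apply: (@raising_eq0 _ _ k0 f _ (fun v => letter_row v == i0)).
- by move=> v /eqP vi; rewrite /swap_rows letterE vi tpermR.
- by move=> v /eqP vi; rewrite /swap_rows letterE vi tpermL.
- exact: swap_rowsK.
move=> v t; rewrite -[RHS]evalMat_of -(hw_mull _ (upper_unitriangular_elem t lt_i)).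
rewrite evalMatE; apply: meval_eq => x; rewrite mulmxDl mul1mx -scalemxAl !mxE letter_rankE.
congr (_ + t * _); rewrite (bigD1 i1) //= big1 ?addr0 => [|i ne_i]; last first.
  by rewrite mxE (negPf ne_i) andbF mul0r.
rewrite !mxE eqxx andbT /swap_rows; case: eqP => [->|_]; last by rewrite mul0r.
by rewrite tpermL mul1r.
Qed.

(** On the right, [t] times column [j0] is added to column [j1], so the smaller and the larger index
    exchange their roles. *)
Lemma hw_raise_cols (j0 j1 : 'I_s) : (j0 < j1)%N ->
  \sum_(v | letter_col v == j0) 'X_v * f^`M(swap_cols j0 j1 v) = 0.
Proof.
move=> lt_j; apply: (@raising_eq0 _ _ k0 f _ (fun v => letter_col v == j1)).
- by move=> v /eqP vi; rewrite /swap_cols letterE vi tpermL.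
- by move=> v /eqP vi; rewrite /swap_cols letterE vi tpermR.
- exact: swap_colsK.
move=> v t; rewrite -[RHS]evalMat_of -(hw_mulr _ (upper_unitriangular_elem t lt_j)).
rewrite evalMatE; apply: meval_eq => x; rewrite mulmxDr mulmx1 -scalemxAr !mxE letter_rankE.
congr (_ + t * _); rewrite (bigD1 j0) //= big1 ?addr0 => [|j ne_j]; last first.
  by rewrite !mxE (negPf ne_j) mulr0.
rewrite !mxE eqxx /swap_cols; case: eqP => [->|_]; last by rewrite mulr0.
by rewrite tpermR mulr1.
Qed.

(** These torus elements suffice to read off degrees, since powers of 2 with distinct exponents are
    distinct in characteristic zero. *)
Definition doubling p (i : 'I_p) : 'M[k]_p :=
  diag_mx (\row_j (if j == i then 2%:R else 1)).

Lemma torus_doubling p (i : 'I_p) : torus (doubling i).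
Proof.
rewrite /torus diag_mx_is_diag unitmxE det_diag unitfE.
apply/prodf_neq0 => j _; rewrite mxE; case: ifP => _; last exact: oner_neq0.
exact: natr_neq0.
Qed.

Lemma torus_char1 p (xi : 'I_p -> int) : torus_char xi (1%:M : 'M[k]_p) = 1.
Proof. by apply: big1 => i _; rewrite mxE eqxx exp1rz. Qed.

Lemma torus1 p : torus (1%:M : 'M[k]_p).
Proof. by rewrite /torus scalar_mx_is_diag unitmx1. Qed.

Lemma torus_char_doubling p (xi : 'I_p -> int) (i : 'I_p) :
  torus_char xi (doubling i) = 2%:R ^ xi i.
Proof.
rewrite /torus_char (bigD1 i) //= big1 ?mulr1 => [|j ne_j].
  by rewrite !mxE !eqxx.
by rewrite !mxE eqxx (negPf ne_j) exp1rz.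
Qed.

Lemma degree_of_doubling (b : pred 'I_#|{: 'I_m * 'I_r * 'I_s}|) (d : nat) :
    (forall v, f.@[fun x => (if b x then 2%:R else 1) * v x] = 2%:R ^+ d * f.@[v]) ->
  forall mm, mm \in msupp f -> (\sum_v mm v * b v = d)%N.
Proof.
move=> f2 mm fmm; have := msupp_scaling k0 f2 fmm.
have -> : \prod_i (if b i then 2%:R else 1) ^+ mm i = 2%:R ^+ (\sum_v mm v * b v) :> k.
  rewrite (big_morph _ (exprD _) (expr0 _)); apply: eq_bigr => v _.
  by case: (b v); rewrite ?muln1 ?muln0 ?expr1n ?expr0.
rewrite -!natrX => /(natr_inj k0)/eqP; rewrite eqn_exp2l //.
by move/eqP.
Qed.

Lemma hw_row_degree i d : chi i = - (d%:Z) ->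
  forall mm, mm \in msupp f -> (\sum_v mm v * (letter_row v == i) = d)%N.
Proof.
move=> chi_i; apply: degree_of_doubling => v; have [_ hwT] := hw.
have /(_ (fun l => doubling i *m mat_of v l)) := hwT _ _ (torus_doubling i) (torus1 s).
rewrite torus_char1 mulr1 torus_char_doubling chi_i.
have -> : act_kMat (doubling i) 1%:M f (fun l => doubling i *m mat_of v l) = f.@[v].
  rewrite -evalMat_of; apply: eq_evalMat => l; rewrite /actMat !invmx1 mulmx1 mulKmx //.
  by case/andP: (torus_doubling i).
have -> : evalMat f (fun l => doubling i *m mat_of v l) =
    f.@[fun x => (if letter_row x == i then 2%:R else 1) * v x].
  rewrite evalMatE; apply: meval_eq => x; rewrite mul_diag_mx !mxE letter_rankE.
  by [].
move=> ->; rewrite -exprnN mulrA mulfV ?mul1r //.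
by rewrite expf_eq0 (negPf (natr_neq0 k0 _)) // andbF.
Qed.

Lemma hw_col_degree j d : psi j = d%:Z ->
  forall mm, mm \in msupp f -> (\sum_v mm v * (letter_col v == j) = d)%N.
Proof.
move=> psi_j; apply: degree_of_doubling => v; have [_ hwT] := hw.
have /(_ (mat_of v)) := hwT _ _ (torus1 r) (torus_doubling j).
rewrite torus_char1 mul1r torus_char_doubling psi_j evalMat_of => <-.
rewrite /act_kMat evalMatE; apply: meval_eq => x.
rewrite /actMat invmx1 mul1mx invmxK mul_mx_diag !mxE letter_rankE mulrC.
by [].
Qed.

End Invariant.
End HighestWeight.

(** * The picture of a leading monomial *)

Lemma word_of_mnm n (mm : 'X_{1..n}) :
  exists (T : finType) (w : T -> 'I_n), word_mon w = mm.
Proof.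
exists 'I_(size (m2s mm)), (tnth (in_tuple (m2s mm))); apply/mnmP => v.
rewrite word_monE -[in RHS](s2mK mm) mnmE -sum1_count big_tnth -sum1_card.
by apply: eq_bigl => a; rewrite inE.
Qed.

Lemma leq_lex (N l l' j j' : nat) : (j < N)%N -> (N * l + j <= N * l' + j')%N ->
  (j' < N)%N -> (l <= l')%N.
Proof.
move=> lt_j le_k lt_j'; rewrite leqNgt; apply/negP => lt_l.
have : (N * l'.+1 <= N * l)%N by rewrite leq_mul2l lt_l orbT.
by rewrite mulnS; lia.
Qed.

Lemma sub_rev_ord (n : nat) (i : 'I_n) : (n - rev_ord i = i.+1)%N.
Proof. by rewrite /=; have := ltn_ord i; lia. Qed.

Section TableauWord.
Variables (m r s : nat) (la mu : seq nat).
Hypotheses (hmu : (size mu <= r)%N) (hla : (size la <= s)%N).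

Definition tableau_word (Q : box mu -> 'I_m) (f : box mu -> 'I_(size mu))
    (g : box mu -> 'I_(size la)) (a : box mu) : 'I_#|{: 'I_m * 'I_r * 'I_s}| :=
  enum_rank (Q a, rev_ord (widen_ord hmu (f a)), widen_ord hla (g a)).

Lemma tableau_word_weight N Q f g :
  (\sum_v word_mon (tableau_word Q f g) v * weight_of_letter N v =
   \sum_a letter_weight N m r s (Q a) (f a) (g a))%N.
Proof.
rewrite word_mon_sum; apply: eq_bigr => a _.
by rewrite /weight_of_letter !letterE rev_ordK.
Qed.
End TableauWord.

Section LeadingPicture.
Variables (k : fieldType) (m r s : nat) (la mu : seq nat).
Hypothesis k0 : [pchar k] =i pred0.
Hypotheses (la_sorted : sorted geq la) (mu_sorted : sorted geq mu).
Hypotheses (hmu : (size mu <= r)%N) (hla : (size la <= s)%N).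
Variables (f : coord_ring k m r s) (N : nat) (mm : 'X_{1..#|{: 'I_m * 'I_r * 'I_s}|}).
Hypotheses (le_rN : (r <= N)%N) (le_sN : (s <= N)%N).
Hypothesis hw : highest_weight_space (fun i => - (nth 0%N mu (rev_ord i))%:Z)
   (fun j => (nth 0%N la j)%:Z) f.
Hypothesis f_mm : mm \in msupp f.
Hypothesis mm_max : forall m', m' \in msupp f ->
  (\sum_v m' v * weight_of_letter N v <= \sum_v mm v * weight_of_letter N v)%N.

Variables (T : finType) (w : T -> 'I_#|{: 'I_m * 'I_r * 'I_s}|).
Hypothesis w_mm : word_mon w = mm.

Let w_max (w' : T -> 'I_#|{: 'I_m * 'I_r * 'I_s}|) : f@_(word_mon w') != 0 ->
  (\sum_a weight_of_letter N (w' a) <= \sum_a weight_of_letter N (w a))%N.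
Proof. by rewrite -mcoeff_msupp => /mm_max; rewrite -w_mm !word_mon_sum. Qed.

(** As [s <= N] and [r <= N], these keys encode lexicographic orders: level then column,
    respectively level then reversed row. *)
Let rowkey (v : 'I_#|{: 'I_m * 'I_r * 'I_s}|) : nat := N * letter_level v + letter_col v.
Let colkey (v : 'I_#|{: 'I_m * 'I_r * 'I_s}|) : nat := N * letter_level v + rev_ord (letter_row v).

(** The torus weight gives the number of letters in each row, and [leading_monomial_lattice] for two
    adjacent matrix rows gives the lattice hypothesis of [lattice_tableau]. *)
Lemma leading_row_tableau : exists theta : box mu -> T,
  [/\ bijective theta, forall b, rev_ord (letter_row (w (theta b))) = brow b :> nat,
      forall a b, brow a = brow b -> (bcol a <= bcol b)%N ->
        (rowkey (w (theta a)) <= rowkey (w (theta b)))%N &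
      forall a b, bcol a = bcol b -> (brow a < brow b)%N ->
        (rowkey (w (theta a)) < rowkey (w (theta b)))%N].
Proof.
apply: (@lattice_tableau mu T (fun a => rev_ord (letter_row (w a))) (fun a => rowkey (w a))) => //.
- move=> e; have [lt_e|le_e] := ltnP e r; last first.
    rewrite nth_default ?(leq_trans hmu) // (_ : [set _ | _] = set0) ?cards0 //.
    by apply/setP => a; rewrite !inE ltn_eqF // (leq_trans (ltn_ord _)).
  pose i := rev_ord (Ordinal lt_e).
  have chi_i : - (nth 0%N mu (rev_ord i))%:Z = - (nth 0%N mu e)%:Z by rewrite rev_ordK.
  rewrite -(hw_row_degree k0 hw chi_i f_mm) -w_mm word_mon_sum -sum1_card big_mkcond.
  apply: eq_bigr => a _; rewrite inE -(inj_eq rev_ord_inj (letter_row _)) rev_ordK.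
  by rewrite -val_eqE /=; case: eqP.
- move=> e c; have [lt_e|le_e] := ltnP e.+1 r; last first.
    rewrite (_ : [set _ | _ & (_ <= _)%N] = set0) ?cards0 //.
    apply/setP => a; rewrite !inE ltn_eqF //.
    by apply: leq_trans le_e; apply: ltn_ord.
  (* Diagram rows are reversed matrix rows: [e] corresponds to [i1], and [e.+1] to [i0], which is
     one less than [i1]. *)
  pose i1 := rev_ord (Ordinal (ltnW lt_e)); pose i0 := rev_ord (Ordinal lt_e).
  have i1E : i1 = i0.+1 :> nat by rewrite /=; lia.
  have lt_i : (i0 < i1)%N by rewrite i1E.
  have rhoE1 a : (rev_ord (letter_row (w a)) == e :> nat) = (letter_row (w a) == i1).
    by rewrite -(inj_eq rev_ord_inj (letter_row _)) rev_ordK -val_eqE.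
  have rhoE0 a : (rev_ord (letter_row (w a)) == e.+1 :> nat) = (letter_row (w a) == i0).
    by rewrite -(inj_eq rev_ord_inj (letter_row _)) rev_ordK -val_eqE.
  (* Moving a variable of level [l] and column [j] from row [i1] to row [i0] lowers its weight by
     [N * (m - l) + (s - j)], which is [N * m + s] minus its [rowkey]. *)
  have := @leading_monomial_lattice k _ f T w k0 (fun v => letter_row v == i1)
    (fun v => letter_row v == i0) (swap_rows i0 i1) rowkey (weight_of_letter N) (N * m + s).
  move=> /(_ _ _ _ _ _ _ _ (hw_raise_rows k0 hw lt_i) _ w_max c) H.
  under eq_finset do rewrite rhoE0.
  under [in X in (_ <= X)%N]eq_finset do rewrite rhoE1.
  apply: H.
  + by move=> v /eqP vi; rewrite /swap_rows letterE vi tpermR.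
  + by move=> v /eqP vi; rewrite /swap_rows letterE vi tpermL.
  + by move=> v _; apply: swap_rowsK.
  + by move=> v /eqP->; apply: contraTN lt_i => /eqP->; rewrite ltnn.
  + by move=> v _; rewrite /rowkey /swap_rows !letterE.
  + move=> u v /eqP ui /eqP vi eq_k; rewrite -[u]letter_rankE -[v]letter_rankE ui vi.
    have lt_c x := leq_trans (ltn_ord (@letter_col m r s x)) le_sN.
    have le1 : (letter_level u <= letter_level v)%N.
      by apply: (@leq_lex N _ _ (letter_col u) (letter_col v)); rewrite // -/(rowkey u) eq_k.
    have le2 : (letter_level v <= letter_level u)%N.
      by apply: (@leq_lex N _ _ (letter_col v) (letter_col u)); rewrite // -/(rowkey u) eq_k.
    have eq_l : letter_level u = letter_level v by apply: val_inj => /=; lia.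
    have -> : letter_col u = letter_col v.
      by apply: val_inj; move: eq_k; rewrite /rowkey eq_l => /addnI.
    by rewrite eq_l.
  + move=> v /eqP vi; rewrite /rowkey /weight_of_letter /letter_weight.
    rewrite /swap_rows !letterE vi tpermR !sub_rev_ord i1E.
    have lt_l := ltn_ord (letter_level v); have lt_c := ltn_ord (letter_col v).
    have -> : (N * m = N * (m - letter_level v) + N * letter_level v)%N.
      by rewrite -mulnDr subnK // ltnW.
    by rewrite !mulnS !mulSn !mulnDr; lia.
  + by rewrite -mcoeff_msupp w_mm.
Qed.

Lemma leading_col_tableau : exists theta : box la -> T,
  [/\ bijective theta, forall b, letter_col (w (theta b)) = brow b :> nat,
      forall a b, brow a = brow b -> (bcol a <= bcol b)%N ->
        (colkey (w (theta a)) <= colkey (w (theta b)))%N &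
      forall a b, bcol a = bcol b -> (brow a < brow b)%N ->
        (colkey (w (theta a)) < colkey (w (theta b)))%N].
Proof.
apply: (@lattice_tableau la T (fun a => letter_col (w a)) (fun a => colkey (w a))) => //.
- move=> e; have [lt_e|le_e] := ltnP e s; last first.
    rewrite nth_default ?(leq_trans hla) // (_ : [set _ | _] = set0) ?cards0 //.
    by apply/setP => a; rewrite !inE ltn_eqF // (leq_trans (ltn_ord _)).
  pose j := Ordinal lt_e.
  have psi_j : (nth 0%N la j)%:Z = (nth 0%N la e)%:Z by [].
  rewrite -(hw_col_degree k0 hw psi_j f_mm) -w_mm word_mon_sum -sum1_card big_mkcond.
  by apply: eq_bigr => a _; rewrite inE -val_eqE /=; case: eqP.
- move=> e c; have [lt_e|le_e] := ltnP e.+1 s; last first.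
    rewrite (_ : [set _ | _ & (_ <= _)%N] = set0) ?cards0 //.
    apply/setP => a; rewrite !inE ltn_eqF //.
    by apply: leq_trans le_e; apply: ltn_ord.
  pose j0 := Ordinal (ltnW lt_e); pose j1 := Ordinal lt_e.
  have lt_j : (j0 < j1)%N by [].
  have rhoE0 a : (letter_col (w a) == e :> nat) = (letter_col (w a) == j0).
    by rewrite -val_eqE.
  have rhoE1 a : (letter_col (w a) == e.+1 :> nat) = (letter_col (w a) == j1).
    by rewrite -val_eqE.
  (* Moving a variable of level [l] and reversed row [i] from column [j0] to column [j1] lowers its
     weight by [N * (m - l) + (r - i)], which is [N * m + r] minus its [colkey]. *)
  have := @leading_monomial_lattice k _ f T w k0 (fun v => letter_col v == j0)
    (fun v => letter_col v == j1) (swap_cols j0 j1) colkey (weight_of_letter N) (N * m + r).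
  move=> /(_ _ _ _ _ _ _ _ (hw_raise_cols k0 hw lt_j) _ w_max c) H.
  under eq_finset do rewrite rhoE1.
  under [in X in (_ <= X)%N]eq_finset do rewrite rhoE0.
  apply: H.
  + by move=> v /eqP vi; rewrite /swap_cols letterE vi tpermL.
  + by move=> v /eqP vi; rewrite /swap_cols letterE vi tpermR.
  + by move=> v _; apply: swap_colsK.
  + by move=> v /eqP->; apply: contraTN lt_j => /eqP->; rewrite ltnn.
  + by move=> v _; rewrite /colkey /swap_cols !letterE.
  + move=> u v /eqP ui /eqP vi eq_k; rewrite -[u]letter_rankE -[v]letter_rankE ui vi.
    have lt_c x := leq_trans (ltn_ord (rev_ord (@letter_row m r s x))) le_rN.
    have le1 : (letter_level u <= letter_level v)%N.
      apply: (@leq_lex N _ _ (rev_ord (letter_row u)) (rev_ord (letter_row v))) => //.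
      by rewrite -/(colkey u) eq_k.
    have le2 : (letter_level v <= letter_level u)%N.
      apply: (@leq_lex N _ _ (rev_ord (letter_row v)) (rev_ord (letter_row u))) => //.
      by rewrite -/(colkey u) eq_k.
    have eq_l : letter_level u = letter_level v by apply: val_inj => /=; lia.
    have -> : letter_row u = letter_row v.
      by apply/rev_ord_inj/val_inj; move: eq_k; rewrite /colkey eq_l => /addnI.
    by rewrite eq_l.
  + move=> v /eqP vi; rewrite /colkey /weight_of_letter /letter_weight.
    rewrite /swap_cols !letterE vi tpermL !sub_rev_ord.
    have lt_l := ltn_ord (letter_level v).
    have e_r : r = (rev_ord (letter_row v) + (letter_row v).+1)%N.
      by rewrite -sub_rev_ord subnKC // ltnW.
    have -> : (N * m = N * (m - letter_level v) + N * letter_level v)%N.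
      by rewrite -mulnDr subnK // ltnW.
    have -> : (s - j0 = (s - j1).+1)%N by rewrite /=; lia.
    by rewrite !mulnS !mulnDr; lia.
  + by rewrite -mcoeff_msupp w_mm.
Qed.

End LeadingPicture.

(** The row and the column tableau are filled with the same letters, and [alpha] matches the boxes
    carrying the same one. Levels give [Q] and [P]; comparing lexicographic keys gives their order
    and, inside a fiber, the order of rows. The mapping obtained satisfies condition (b);
    admissibility enters later with the choice of a representative. *)
Lemma leading_picture (k : fieldType) (m r s : nat) (la mu : seq nat)
    (hmu : (size mu <= r)%N) (hla : (size la <= s)%N)
    (f : coord_ring k m r s) (N : nat) (mm : 'X_{1..#|{: 'I_m * 'I_r * 'I_s}|}) :
    [pchar k] =i pred0 -> sorted geq la -> sorted geq mu -> (r <= N)%N -> (s <= N)%N ->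
    highest_weight_space (fun i => - (nth 0%N mu (rev_ord i))%:Z)
      (fun j => (nth 0%N la j)%:Z) f ->
    mm \in msupp f ->
    (forall m', m' \in msupp f ->
      (\sum_v m' v * weight_of_letter N v <= \sum_v mm v * weight_of_letter N v)%N) ->
  exists (P : {ffun box la -> 'I_m}) (Q : {ffun box mu -> 'I_m}) (alpha : box mu -> box la),
    [/\ bijective alpha, P \o alpha =1 Q, ordered P /\ ordered Q,
        [/\ forall a b, Q a = Q b -> brow a = brow b -> (bcol a <= bcol b)%N ->
              (brow (alpha a) <= brow (alpha b))%N,
            forall a b, Q a = Q b -> bcol a = bcol b -> (brow a < brow b)%N ->
              (brow (alpha a) < brow (alpha b))%N &
            forall a b, Q a = Q b -> bcol (alpha a) = bcol (alpha b) ->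
              (brow (alpha a) < brow (alpha b))%N -> (brow a < brow b)%N] &
        mm = word_mon (tableau_word hmu hla Q (fun a => brow a)
                                    (fun a => brow (alpha a)))].
Proof.
move=> k0 la_sorted mu_sorted le_rN le_sN hw f_mm mm_max.
have [T [w w_mm]] := word_of_mnm mm.
have [th [th_bij th_row th_le th_lt]] :=
  leading_row_tableau k0 la_sorted mu_sorted hmu hla le_rN le_sN hw f_mm mm_max w_mm.
have [th' [th'_bij th'_row th'_le th'_lt]] :=
  leading_col_tableau k0 la_sorted mu_sorted hmu hla le_rN le_sN hw f_mm mm_max w_mm.
have [g' th'K g'K] := th'_bij; have [g thK gK] := th_bij.
have th'a a : th' (g' (th a)) = th a by rewrite g'K.
have lt_c x : (@letter_col m r s x < N)%N by apply: leq_trans le_sN.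
have lt_r x : (rev_ord (@letter_row m r s x) < N)%N by apply: leq_trans le_rN; apply: ltn_ord.
exists [ffun b => letter_level (w (th' b))], [ffun a => letter_level (w (th a))].
exists (fun a => g' (th a)); split.
- by exists (fun b => g (th' b)) => x; rewrite ?g'K ?thK ?gK ?th'K.
- by move=> a; rewrite /= !ffunE th'a.
- split; split=> a b; rewrite !ffunE.
  + by move=> eq_r le_c; apply: leq_lex (lt_r _) (th'_le _ _ eq_r le_c) (lt_r _).
  + move=> eq_c; rewrite leq_eqVlt => /predU1P[eq_r|lt_ab].
      by rewrite (box_inj eq_r eq_c).
    by apply: leq_lex (lt_r _) (ltnW (th'_lt _ _ eq_c lt_ab)) (lt_r _).
  + by move=> eq_r le_c; apply: leq_lex (lt_c _) (th_le _ _ eq_r le_c) (lt_c _).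
  + move=> eq_c; rewrite leq_eqVlt => /predU1P[eq_r|lt_ab].
      by rewrite (box_inj eq_r eq_c).
    by apply: leq_lex (lt_c _) (ltnW (th_lt _ _ eq_c lt_ab)) (lt_c _).
- split=> a b; rewrite !ffunE => eq_l.
  + by move=> eq_r /(th_le _ _ eq_r); rewrite eq_l leq_add2l -!th'_row !th'a.
  + by move=> eq_c /(th_lt _ _ eq_c); rewrite eq_l ltn_add2l -!th'_row !th'a.
  + by move=> eq_c /(th'_lt _ _ eq_c); rewrite !th'a eq_l ltn_add2l !th_row.
rewrite -w_mm; apply: etrans (eq_bigr _ _).
  by rewrite /word_mon (reindex th) //=; apply: onW_bij.
move=> a _; congr U_(_)%MM; rewrite /tableau_word ffunE -[LHS]letter_rankE.
congr (enum_rank (_, _, _)).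
  by apply/rev_ord_inj/ord_inj; rewrite th_row rev_ordK.
by apply: val_inj; rewrite /= -th'_row th'a.
Qed.


(** * Alternants *)

Section Alternants.
Variables (k : fieldType) (mu : seq nat) (n : nat).
Hypothesis k0 : [pchar k] =i pred0.
Hypothesis mu_sorted : sorted geq mu.
Hypothesis hmu : (size mu <= n)%N.
Local Notation row b := (widen_ord hmu (brow b)).

(** Composing [p] with the transposition of [a] and [b] changes the sign and keeps the product, so
    the sum is its own negative. *)
Lemma alternant_eq0 (c : 'I_n -> 'I_n -> k) (e : box mu -> 'I_n) (a b : box mu) :
    a != b -> bcol a = bcol b -> e a = e b ->
  \sum_(p in col_stab mu) sgn k p * \prod_x c (row (p x)) (e x) = 0.
Proof.
move=> ne_ab eq_c eq_e; set S := LHS.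
suff /eqP : S = - S.
  rewrite -addr_eq0 -mulr2n -mulr_natr mulf_eq0 (negPf (natr_neq0 k0 _)) // orbF.
  by move/eqP.
pose tau := tperm a b.
have tauC x : bcol (tau x) = bcol x by rewrite /tau; case: tpermP => // ->.
have tauE x : e (tau x) = e x by rewrite /tau; case: tpermP => // ->.
rewrite /S [LHS](reindex_inj (mulgI tau)) -sumrN; apply: eq_big => p.
  rewrite !inE; apply/forallP/forallP => pC x.
    by have := pC (tau x); rewrite permM tpermK tauC.
  by rewrite permM (eqP (pC _)) tauC.
move=> _; rewrite /sgn odd_permM odd_tperm ne_ab signrN mulNr; congr (- (_ * _)).
rewrite [RHS](reindex_inj (@perm_inj _ tau)); apply: eq_bigr => x _.
by rewrite permM tauE.
Qed.

Lemma alternant_unitriangular (c : 'I_n -> 'I_n -> k) (e : box mu -> 'I_n) :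
    (forall i j : 'I_n, (i < j)%N -> c i j = 0) -> (forall i, c i i = 1) ->
  \sum_(p in col_stab mu) sgn k p * \prod_a c (row (p a)) (e a) =
  \sum_(p in col_stab mu) sgn k p * \prod_a (row (p a) == e a)%:R.
Proof.
move=> c0 c1.
(* If [e] repeats a value in a column, both alternants vanish; otherwise a nonzero
   term needs [e <= row o p], hence [e = row o p] by comparing sums. *)
have [/existsP[a /existsP[b /and3P[ne_ab /eqP eq_c /eqP eq_e]]]|] :=
  boolP [exists a : box mu, exists b, [&& a != b, bcol a == bcol b & e a == e b]].
  by rewrite (alternant_eq0 c ne_ab) // (alternant_eq0 (fun i j => (i == j)%:R) ne_ab).
rewrite negb_exists => /forallP e_inj; apply: eq_bigr => p pC; congr (_ * _).
have [/forallP eq_e|] := boolP [forall a, row (p a) == e a].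
  by apply: eq_bigr => a _; rewrite -(eqP (eq_e a)) c1 eqxx.
rewrite negb_forall => /existsP[a0 ne_a0].
rewrite [RHS](bigD1 a0) //= (negPf ne_a0) mul0r.
have [/existsP[a lt_a]|] := boolP [exists a, (brow (p a) < e a)%N].
  by rewrite (bigD1 a) //= c0 ?mul0r.
rewrite negb_exists => /forallP le_e; case/negP: ne_a0.
have rhoP a : exists b : box mu, brow b = e a :> nat /\ bcol b = bcol a.
  have [|b [rb cb]] := @box_above mu (p a) (e a) mu_sorted.
    by rewrite leqNgt le_e.
  by exists b; rewrite rb cb (col_stabE _ pC).
have [rho rhoE] := fin_all_exists rhoP.
have rho_inj : injective rho.
  move=> a b eq_ab; have [ra ca] := rhoE a; have [rb cb] := rhoE b.
  have eq_e : e a = e b by apply/ord_inj; rewrite -ra -rb eq_ab.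
  have eq_c : bcol a = bcol b by rewrite -ca -cb eq_ab.
  have := e_inj a; rewrite negb_exists => /forallP/(_ b).
  by rewrite eq_c eq_e !eqxx !andbT negbK => /eqP.
have sumE (q : {perm box mu}) : (\sum_a brow (q a) = \sum_(a : box mu) brow a)%N.
  by apply/esym; apply: (reindex_inj (@perm_inj _ q)).
have := @sum_leq_eq _ (fun a => brow (rho a)) (fun a => brow (p a)).
move=> /(_ _ _ a0) eq_r; apply/eqP/ord_inj; rewrite /= -eq_r.
- by case: (rhoE a0).
- by move=> a; have [-> _] := rhoE a; rewrite leqNgt le_e.
rewrite sumE -(sumE (perm rho_inj)).
by apply: eq_bigr => a _; rewrite permE.
Qed.

(** Expand the product over all choices [e] of indices. Each coefficient is the alternant of [c] at
    [e], which [alternant_unitriangular] identifies with that of the identity matrix. *)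
Lemma alternant_invariant (c : 'I_n -> 'I_n -> k) (B : box mu -> 'I_n -> k) :
    (forall i j : 'I_n, (i < j)%N -> c i j = 0) -> (forall i, c i i = 1) ->
  \sum_(p in col_stab mu) sgn k p * \prod_a \sum_i c (row (p a)) i * B a i =
  \sum_(p in col_stab mu) sgn k p * \prod_a B a (row (p a)).
Proof.
move=> c0 c1.
have expand (d : 'I_n -> 'I_n -> k) :
    \sum_(p in col_stab mu) sgn k p * \prod_a \sum_i d (row (p a)) i * B a i =
    \sum_(e : {ffun box mu -> 'I_n})
      (\sum_(p in col_stab mu) sgn k p * \prod_a d (row (p a)) (e a)) *
      \prod_a B a (e a).
  under eq_bigr do rewrite bigA_distr_bigA mulr_sumr.
  rewrite exchange_big; apply: eq_bigr => e _; rewrite mulr_suml.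
  by apply: eq_bigr => p _; rewrite big_split mulrA.
rewrite expand; under eq_bigr do rewrite alternant_unitriangular //.
rewrite -(expand (fun i j => (i == j)%:R)); apply: eq_bigr => p _; congr (_ * _).
apply: eq_bigr => a _; rewrite (bigD1 (row (p a))) //= eqxx mul1r big1 ?addr0 // => i.
by rewrite eq_sym => /negPf->; rewrite mul0r.
Qed.

End Alternants.

Lemma card_box_row (mu : seq nat) (e : nat) :
  #|[set a : box mu | brow a == e :> nat]| = nth 0 mu e.
Proof.
have [lt_e|le_e] := ltnP e (size mu); last first.
  rewrite nth_default // (_ : [set _ | _] = set0) ?cards0 //.
  by apply/setP => a; rewrite !inE ltn_eqF // (leq_trans (ltn_ord _)).
pose g (x : 'I_(nth 0 mu e)) : box mu := existT _ (Ordinal lt_e) x.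
have g_inj : injective g.
  move=> x y /(congr1 (@bcol mu)); rewrite /bcol /= => eq_xy; exact: val_inj.
rewrite -[RHS]card_ord -(card_imset _ g_inj); apply: eq_card => a.
rewrite inE; apply/eqP/imsetP => [ra|[x _ ->] //].
have lt_a : (bcol a < nth 0 mu e)%N by rewrite -ra bcol_lt.
by exists (Ordinal lt_a) => //; apply: box_inj.
Qed.

(** * The elements u are highest weight vectors *)

Section UElt.
Variables (k : fieldType) (m r s : nat) (la mu : seq nat).
Hypothesis k0 : [pchar k] =i pred0.
Hypotheses (la_sorted : sorted geq la) (mu_sorted : sorted geq mu).
Hypotheses (hmu : (size mu <= r)%N) (hla : (size la <= s)%N).
Variables (Q : box mu -> 'I_m) (alpha : box mu -> box la).
Hypothesis alpha_bij : bijective alpha.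
Local Notation u := (u_elt k hmu hla Q alpha).
Implicit Types A : 'I_m -> 'M[k]_(r, s).

Lemma evalMat_u A : evalMat u A =
  \sum_(p in col_stab mu) \sum_(q in col_stab la) sgn k p * sgn k q *
    \prod_a A (Q a) (rev_ord (widen_ord hmu (brow (p a)))) (widen_ord hla (brow (q (alpha a)))).
Proof.
rewrite evalMatE /u_elt raddf_sum; apply: eq_bigr => p _ /=.
rewrite raddf_sum; apply: eq_bigr => q _ /=; rewrite mevalZ rmorph_prod; congr (_ * _).
by apply: eq_bigr => a _ /=; rewrite /entry mevalXU !letterE.
Qed.

(** For fixed [q] the sum over [p] is an alternant, and the reversal of row indices makes [R] lower
    unitriangular, as [alternant_invariant] requires. *)
Lemma evalMat_u_mull R A : upper_unitriangular R ->
  evalMat u (fun l => R *m A l) = evalMat u A.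
Proof.
case/andP=> /is_trig_mxP R0 /forallP R1; rewrite !evalMat_u exchange_big [RHS]exchange_big /=.
apply: eq_bigr => q _.
pose B a i := A (Q a) (rev_ord i) (widen_ord hla (brow (q (alpha a)))).
pose c i j := R (rev_ord i) (rev_ord j).
have c0 (i j : 'I_r) : (i < j)%N -> c i j = 0.
  move=> lt_ij; have := R0 (rev_ord j) (rev_ord i); rewrite mxE; apply.
  by rewrite /=; have := ltn_ord j; lia.
have c1 i : c i i = 1 by apply/eqP/R1.
have pull (F : {perm box mu} -> k) : \sum_(p in col_stab mu) sgn k p * sgn k q * F p =
    sgn k q * \sum_(p in col_stab mu) sgn k p * F p.
  by rewrite mulr_sumr; apply: eq_bigr => p _; rewrite mulrA (mulrC (sgn k q)).
rewrite !pull; congr (_ * _); rewrite -[RHS](alternant_invariant k0 mu_sorted hmu B c0 c1).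
apply: eq_bigr => p _; congr (_ * _); apply: eq_bigr => a _.
by rewrite mxE (reindex_inj rev_ord_inj).
Qed.

(** For fixed [p] the product is reindexed by [alpha] over the boxes of [la], and the transpose of
    [S] serves as [c]. *)
Lemma evalMat_u_mulr S A : upper_unitriangular S ->
  evalMat u (fun l => A l *m S) = evalMat u A.
Proof.
case/andP=> /is_trig_mxP S0 /forallP S1; rewrite !evalMat_u.
apply: eq_bigr => p _; have [beta alphaK betaK] := alpha_bij.
pose B b j := A (Q (beta b)) (rev_ord (widen_ord hmu (brow (p (beta b))))) j.
pose c i j := S j i.
have c0 (i j : 'I_s) : (i < j)%N -> c i j = 0.
  by move=> lt_ij; have := S0 i j lt_ij; rewrite mxE.
have c1 i : c i i = 1 by apply/eqP/S1.
have pull (F : {perm box la} -> k) : \sum_(q in col_stab la) sgn k p * sgn k q * F q =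
    sgn k p * \sum_(q in col_stab la) sgn k q * F q.
  by rewrite mulr_sumr; apply: eq_bigr => q _; rewrite mulrA.
rewrite !pull; congr (_ * _).
have prodE (F : box mu -> box la -> k) : \prod_a F a (alpha a) = \prod_b F (beta b) b.
  rewrite [RHS](reindex alpha) /=; last exact: onW_bij.
  by apply: eq_bigr => a _; rewrite alphaK.
under eq_bigr => q _ do rewrite (prodE (fun a b =>
  (A (Q a) *m S) (rev_ord (widen_ord hmu (brow (p a)))) (widen_ord hla (brow (q b))))).
under [RHS]eq_bigr => q _ do rewrite (prodE (fun a b =>
  A (Q a) (rev_ord (widen_ord hmu (brow (p a)))) (widen_ord hla (brow (q b))))).
rewrite -[RHS](alternant_invariant k0 la_sorted hla B c0 c1).
apply: eq_bigr => q _; congr (_ * _); apply: eq_bigr => b _.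
by rewrite mxE; apply: eq_bigr => j _; rewrite mulrC.
Qed.

(** As [p] permutes the boxes, every term has as many factors from a matrix row as the corresponding
    row of [mu] has boxes. *)
Lemma evalMat_u_diagl (d : 'rV[k]_r) A :
  evalMat u (fun l => diag_mx d *m A l) =
  (\prod_i d 0 i ^+ nth 0%N mu (rev_ord i)) * evalMat u A.
Proof.
rewrite !evalMat_u mulr_sumr; apply: eq_bigr => p _.
rewrite mulr_sumr; apply: eq_bigr => q _; rewrite [RHS]mulrCA; congr (_ * _).
under eq_bigr do rewrite mul_diag_mx mxE.
rewrite big_split; congr (_ * _) => /=.
rewrite -(reindex_inj (@perm_inj _ p) (P := xpredT)
  (F := fun a => d 0 (rev_ord (widen_ord hmu (brow a))))).
rewrite (partition_big (fun a : box mu => rev_ord (widen_ord hmu (brow a))) predT) //=.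
apply: eq_bigr => i _; rewrite -card_box_row -prodr_const big_mkcond [RHS]big_mkcond.
apply: eq_bigr => a _; rewrite inE -(inj_eq rev_ord_inj) rev_ordK -val_eqE /=.
case: eqP => // ra; congr (d 0 _).
by apply/rev_ord_inj/ord_inj; rewrite rev_ordK /= ra.
Qed.

Lemma evalMat_u_diagr (d : 'rV[k]_s) A :
  evalMat u (fun l => A l *m diag_mx d) =
  (\prod_j d 0 j ^+ nth 0%N la j) * evalMat u A.
Proof.
rewrite !evalMat_u mulr_sumr; apply: eq_bigr => p _.
rewrite mulr_sumr; apply: eq_bigr => q _; rewrite [RHS]mulrCA; congr (_ * _).
under eq_bigr do rewrite mul_mx_diag mxE mulrC.
rewrite big_split; congr (_ * _) => /=.
rewrite -(reindex alpha (P := xpredT) (F := fun b => d 0 (widen_ord hla (brow (q b)))));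
  last exact: onW_bij.
rewrite -(reindex_inj (@perm_inj _ q) (P := xpredT)
  (F := fun b => d 0 (widen_ord hla (brow b)))).
rewrite (partition_big (fun b : box la => widen_ord hla (brow b)) predT) //=.
apply: eq_bigr => j _; rewrite -card_box_row -prodr_const big_mkcond [RHS]big_mkcond.
apply: eq_bigr => a _; rewrite inE -val_eqE /=.
by case: eqP => // ra; congr (d 0 _); apply: ord_inj.
Qed.

Lemma u_elt_highest_weight :
  highest_weight_space (fun i => - (nth 0%N mu (rev_ord i))%:Z)
    (fun j => (nth 0%N la j)%:Z) u.
Proof.
split=> [R S upR upS A|D D' /andP[D_diag D_unit] /andP[D'_diag D'_unit] A].
  have -> : act_kMat R S u A = evalMat u (fun l => (invmx R *m A l) *m S).
    by apply: eq_evalMat => l; rewrite /actMat invmxK.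
  rewrite evalMat_u_mulr // -(evalMat_u_mull _ upR); apply: eq_evalMat => l.
  by rewrite mulKVmx // upper_unitriangular_unit.
have -> : act_kMat D D' u A = evalMat u (fun l => (invmx D *m A l) *m D').
  by apply: eq_evalMat => l; rewrite /actMat invmxK.
have /diag_mxP[d def_D] := D_diag; have /diag_mxP[d' def_D'] := D'_diag.
have -> : torus_char (fun j => (nth 0%N la j)%:Z) D' = \prod_j d' 0 j ^+ nth 0%N la j.
  by apply: eq_bigr => j _; rewrite def_D' mxE eqxx.
have nz_d i : d 0 i != 0.
  move: D_unit; rewrite unitmxE def_D det_diag unitfE => /prodf_neq0; exact.
have -> : torus_char (fun i => - (nth 0%N mu (rev_ord i))%:Z) D =
    (\prod_i d 0 i ^+ nth 0%N mu (rev_ord i))^-1.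
  by rewrite -prodfV; apply: eq_bigr => i _; rewrite def_D mxE eqxx -exprnN.
rewrite def_D' evalMat_u_diagr mulrAC mulrC; congr (_ * _).
set c := \prod_i _; have nz_c : c != 0 by apply/prodf_neq0 => i _; rewrite expf_neq0.
(* After multiplication by [c], [evalMat_u_diagl] reintroduces [D], which cancels [invmx D]. *)
apply: (mulfI nz_c); rewrite mulVKf // -evalMat_u_diagl -def_D.
by apply: eq_evalMat => l; rewrite mulKVmx.
Qed.
End UElt.

(** * Leading monomials of the basis elements *)

Section UEltLeading.
Variables (k : fieldType) (m r s : nat) (la mu : seq nat).
Hypothesis k0 : [pchar k] =i pred0.
Hypotheses (hmu : (size mu <= r)%N) (hla : (size la <= s)%N).

Definition tableau_mon (Q : box mu -> 'I_m) (alpha : box mu -> box la) :=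
  word_mon (tableau_word hmu hla Q (fun a => brow a) (fun a => brow (alpha a))).

Definition mnm_weight (N : nat) (mm : 'X_{1..#|{: 'I_m * 'I_r * 'I_s}|}) : nat :=
  (\sum_v mm v * weight_of_letter N v)%N.

Lemma u_eltE (Q : box mu -> 'I_m) (alpha : box mu -> box la) :
  u_elt k hmu hla Q alpha =
  \sum_(p in col_stab mu) \sum_(q in col_stab la) (sgn k p * sgn k q) *:
    'X_[word_mon (tableau_word hmu hla Q (fun a => brow (p a)) (fun a => brow (q (alpha a))))].
Proof.
apply: eq_bigr => p _; apply: eq_bigr => q _; congr (_ *: _).
by rewrite /word_mon (big_morph _ (@mpolyXD _ _) (@mpolyX0 _ _)).
Qed.

(** By [picture_weight] and [odd_perm_conj], every pair [(p, q)] of top weight contributes the same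
    monomial with sign 1. The leading coefficient is therefore the number of such pairs, positive
    because of the identity pair. *)
Lemma u_elt_leading (P : box la -> 'I_m) (Q : box mu -> 'I_m)
    (alpha : box mu -> box la) (N : nat) :
    picture P Q alpha -> (#|{: box mu}| * (r * s) < N)%N ->
  (u_elt k hmu hla Q alpha)@_(tableau_mon Q alpha) != 0 /\
  forall mm, mm \in msupp (u_elt k hmu hla Q alpha) ->
    (mnm_weight N mm <= mnm_weight N (tableau_mon Q alpha))%N /\
    (mnm_weight N mm = mnm_weight N (tableau_mon Q alpha) -> mm = tableau_mon Q alpha).
Proof.
move=> pict ltN.
pose wm (p : {perm box mu}) (q : {perm box la}) := word_mon
  (tableau_word hmu hla Q (fun a => brow (p a)) (fun a => brow (q (alpha a)))).
have coefE mm : (u_elt k hmu hla Q alpha)@_mm = \sum_(p in col_stab mu)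
    \sum_(q in col_stab la) sgn k p * sgn k q * (wm p q == mm)%:R.
  rewrite u_eltE raddf_sum; apply: eq_bigr => p _; rewrite raddf_sum.
  by apply: eq_bigr => q _; rewrite /= mcoeffZ mcoeffX.
have lead p q : p \in col_stab mu -> q \in col_stab la ->
    (mnm_weight N (wm p q) <= mnm_weight N (tableau_mon Q alpha))%N /\
    (mnm_weight N (wm p q) = mnm_weight N (tableau_mon Q alpha) ->
       wm p q = tableau_mon Q alpha /\ sgn k p * sgn k q = 1).
  move=> pC qC; have := picture_weight pict hmu hla ltN pC qC.
  rewrite /mnm_weight !tableau_word_weight => -[le_w rig]; split=> // /rig[qE Qp].
  split; last first.
    have [alpha_bij _ _ _ _] := pict.
    by rewrite /sgn (odd_perm_conj alpha_bij qE) -signr_addb addbb.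
  rewrite /tableau_mon /word_mon [RHS](reindex_inj (@perm_inj _ p)) /=.
  by apply: eq_bigr => a _; rewrite /tableau_word qE Qp.
split=> [|mm].
  rewrite coefE.
  have -> : \sum_(p in col_stab mu) \sum_(q in col_stab la)
      sgn k p * sgn k q * (wm p q == tableau_mon Q alpha)%:R =
    (\sum_(p in col_stab mu) \sum_(q in col_stab la) (wm p q == tableau_mon Q alpha))%:R :> k.
    rewrite natr_sum; apply: eq_bigr => p pC; rewrite natr_sum; apply: eq_bigr => q qC.
    have [eq_w|] := eqVneq (wm p q); last by rewrite mulr0.
    by have [_ [|_ ->]] := lead p q pC qC; rewrite ?eq_w ?mul1r.
  apply: natr_neq0 => //.
  have C1 nu : (1%g : {perm box nu}) \in col_stab nu.
    by rewrite inE; apply/forallP => b; rewrite perm1.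
  rewrite (bigD1 1%g) //= (bigD1 1%g) //=.
  suff -> : wm 1%g 1%g = tableau_mon Q alpha by rewrite eqxx -addnA add1n.
  by apply: eq_word_mon => a; rewrite /tableau_word !perm1.
rewrite mcoeff_msupp coefE => nz.
have [p pC nz_p] : exists2 p, p \in col_stab mu & \sum_(q in col_stab la)
    sgn k p * sgn k q * (wm p q == mm)%:R != 0.
  apply/exists_inP; apply: contraNT nz; rewrite negb_exists => /forallP H.
  by apply/eqP/big1 => p pC; have := H p; rewrite pC negbK => /eqP.
have [q qC nz_q] : exists2 q, q \in col_stab la & sgn k p * sgn k q * (wm p q == mm)%:R != 0.
  apply/exists_inP; apply: contraNT nz_p; rewrite negb_exists => /forallP H.
  by apply/eqP/big1 => q qC; have := H q; rewrite qC negbK => /eqP.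
have <- : wm p q = mm by apply/eqP; apply: contraNT nz_q => /negPf->; rewrite mulr0.
by have [le_w rig] := lead p q pC qC; split=> // /rig[].
Qed.

Lemma eq_word_mon_count n (T : finType) (w w' : T -> 'I_n) (b : pred 'I_n) :
  word_mon w = word_mon w' -> #|[set a | b (w a)]| = #|[set a | b (w' a)]|.
Proof.
move=> eq_w.
have cardE (v : T -> 'I_n) : #|[set a | b (v a)]| = (\sum_a b (v a))%N.
  by rewrite -sum1_card big_mkcond; apply: eq_bigr => a _; rewrite inE; case: (b _).
by rewrite !cardE -!(word_mon_sum _ (fun v => b v : nat)) eq_w.
Qed.

(** For each row of [mu] the monomial records the pairs formed by the level and the row under
    [alpha]. In a picture these increase lexicographically along the row, so [row_sorted_unique]
    recovers them; the content of each row of [la] then determines [P]. *)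
Lemma tableau_mon_inj (P P' : box la -> 'I_m) (Q Q' : box mu -> 'I_m)
    (alpha alpha' : box mu -> box la) :
    picture P Q alpha -> picture P' Q' alpha' ->
    tableau_mon Q alpha = tableau_mon Q' alpha' ->
  [/\ P =1 P', Q =1 Q' & forall a, brow (alpha a) = brow (alpha' a)].
Proof.
move=> pict pict' eq_mon.
have ltS (x : box la) : (brow x < s)%N by apply: leq_trans (ltn_ord _) hla.
pose h (R : box mu -> 'I_m) (f : box mu -> box la) a := (s * R a + brow (f a))%N.
have h_row R0 R f : picture R0 R f -> forall a b, brow a = brow b ->
    (bcol a <= bcol b)%N -> (h R f a <= h R f b)%N.
  move=> [_ _ [_ [Rrow _]] [Srow _] _] a b eq_r le_c; have := Rrow _ _ eq_r le_c.
  rewrite leq_eqVlt => /predU1P[eq_R|lt_R].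
    by rewrite /h eq_R leq_add2l; apply: Srow => //; apply: val_inj.
  have : (s * (R a).+1 <= s * R b)%N by rewrite leq_mul2l lt_R orbT.
  by rewrite mulnS /h; have := ltS (f a); lia.
have eq_h : h Q alpha =1 h Q' alpha'.
  apply: row_sorted_unique (h_row _ _ _ pict) (h_row _ _ _ pict') _ => e d.
  have := eq_word_mon_count (fun v => (rev_ord (letter_row v) == e :> nat) &&
    (s * letter_level v + letter_col v <= d)%N) eq_mon.
  congr (_ = _); apply: eq_card => a; rewrite !inE /tableau_word !letterE rev_ordK;
    by rewrite -val_eqE.
have eqQ a : Q a = Q' a.
  have eq_ha := eq_h a; rewrite /h in eq_ha; apply/ord_inj/eqP; rewrite eqn_leq.
  rewrite (@leq_lex s _ _ (brow (alpha a)) (brow (alpha' a))) ?ltS ?eq_ha //.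
  by rewrite (@leq_lex s _ _ (brow (alpha' a)) (brow (alpha a))) ?ltS ?eq_ha.
have eqS a : brow (alpha a) = brow (alpha' a).
  by apply/ord_inj; have := eq_h a; rewrite /h eqQ => /addnI.
split=> //; have [[beta alphaK betaK] PalphaE [[Prow _] _] _ _] := pict.
have [[beta' alpha'K beta'K] P'alphaE [[P'row _] _] _ _] := pict'.
suff eqP : (fun b => P b : nat) =1 (fun b => P' b : nat) by move=> b; apply/ord_inj/eqP.
apply: row_sorted_unique => // e d.
rewrite -(on_card_preimset (f := alpha)); last first.
  by exists beta => b _; rewrite ?alphaK ?betaK.
rewrite -[RHS](on_card_preimset (f := alpha')); last first.
  by exists beta' => b _; rewrite ?alpha'K ?beta'K.
apply: eq_card => a; rewrite !inE eqS.
by rewrite -[P (alpha a)]/((P \o alpha) a) PalphaE -[P' _]/((P' \o alpha') a) P'alphaE eqQ.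
Qed.

End UEltLeading.

(** * Triangular families of polynomials *)

Lemma highest_weight_sub (k : fieldType) (m r s : nat) (chi : 'I_r -> int)
    (psi : 'I_s -> int) (f g : coord_ring k m r s) (c : k) :
  highest_weight_space chi psi f -> highest_weight_space chi psi g ->
  highest_weight_space chi psi (f - c *: g).
Proof.
have evalB A : evalMat (f - c *: g) A = evalMat f A - c * evalMat g A.
  by rewrite /evalMat mevalB mevalZ.
move=> [fU fT] [gU gT]; split=> [R S upR upS A|D D' tD tD' A].
  by move: (fU R S upR upS A) (gU R S upR upS A); rewrite /act_kMat !evalB => -> ->.
move: (fT D D' tD tD' A) (gT D D' tD tD' A); rewrite /act_kMat !evalB => -> ->.
by rewrite mulrBr [X in _ - X]mulrCA.
Qed.

(** Independence: among the indices with nonzero coefficient take one whose leading monomial is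
    heaviest; no other member contains that monomial. Spanning: multiples of members remove the
    heaviest monomials one at a time. *)
Lemma triangular_basis (k : fieldType) (n : nat) (I : eqType) (D : I -> Prop)
    (v : I -> {mpoly k[n]}) (W : {mpoly k[n]} -> Prop) (M : I -> 'X_{1..n})
    (wt : 'X_{1..n} -> nat) :
    (forall i, D i -> W (v i)) ->
    (forall f g c, W f -> W g -> W (f - c *: g)) ->
    (forall i, D i -> (v i)@_(M i) != 0 /\
       forall mm, mm \in msupp (v i) -> (wt mm <= wt (M i))%N /\
         (wt mm = wt (M i) -> mm = M i)) ->
    (forall i j, D i -> D j -> M i = M j -> i = j) ->
    (forall f mm, W f -> mm \in msupp f ->
       (forall m', m' \in msupp f -> (wt m' <= wt mm)%N) -> exists2 i, D i & M i = mm) ->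
  is_basis D v W.
Proof.
move=> vW subW lead M_inj leadW.
have supp_lead i mm : D i -> (v i)@_mm != 0 -> (wt mm <= wt (M i))%N /\
    (wt mm = wt (M i) -> mm = M i).
  by move=> Di; rewrite -mcoeff_msupp; case: (lead i Di) => _; apply.
split=> //.
- move=> e c e_uniq De sum0 i0 e_i0; apply/eqP; apply: contraT => nz_c0.
  pose nz := [seq i <- e | c i != 0].
  have nz_i0 : i0 \in nz by rewrite mem_filter nz_c0.
  have [i nz_i i_max] : exists2 i, i \in nz &
      forall j, j \in nz -> (wt (M j) <= wt (M i))%N.
    have : nz != [::] by apply: contraTneq nz_i0 => ->.
    elim: nz {nz_i0} => // i s' IH _.
    have [s0|/IH[i' s_i' i'_max]] := eqVneq s' [::].
      by exists i; rewrite ?mem_head // => j; rewrite s0 inE => /eqP->.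
    have [le_i|lt_i] := leqP (wt (M i)) (wt (M i')).
      exists i'; first by rewrite in_cons s_i' orbT.
      by move=> j'; rewrite in_cons => /predU1P[->|/i'_max].
    exists i; first exact: mem_head.
    move=> j'; rewrite in_cons => /predU1P[->//|/i'_max le_j].
    exact: leq_trans le_j (ltnW lt_i).
  move: nz_i; rewrite mem_filter => /andP[nz_ci e_i].
  have := congr1 (mcoeff (M i)) sum0; rewrite mcoeff0 raddf_sum /=.
  rewrite (bigD1_seq i) //= big1_seq ?addr0 => [|j /andP[ne_ji e_j]].
    move/eqP; rewrite mcoeffZ mulf_eq0 (negPf nz_ci) /=.
    by case: (lead i (De i e_i)) => /negPf->.
  rewrite mcoeffZ; apply/eqP; rewrite mulf_eq0; apply: contraNT ne_ji.
  rewrite negb_or => /andP[nz_cj nz_v]; have Dj := De j e_j.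
  have [le_ij rig] := supp_lead j _ Dj nz_v.
  have le_ji : (wt (M j) <= wt (M i))%N by apply: i_max; rewrite mem_filter nz_cj.
  apply/eqP/M_inj => //; first exact: De.
  by apply/esym/rig; apply/eqP; rewrite eqn_leq le_ij.
(* Indices are kept distinct so that a further multiple of [v i] can be merged into an existing
   coefficient. *)
- pose Sp f := exists (e : seq I) (c : I -> k),
    [/\ uniq e, forall i, i \in e -> D i & f = \sum_(i <- e) c i *: v i].
  have SpD f i c : Sp f -> D i -> Sp (f + c *: v i).
    move=> [e [d [e_uniq De ->]]] Di.
    have [e_i|ne_i] := boolP (i \in e).
      exists e, (fun j => if j == i then d i + c else d j); split=> //.
      rewrite (bigD1_seq i) //= [RHS](bigD1_seq i) //= eqxx scalerDl addrAC.
      by congr (_ + _); apply: eq_bigr => j /negPf->.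
    exists (i :: e), (fun j => if j == i then c else d j); split=> [||].
    + by rewrite /= ne_i.
    + by move=> j; rewrite in_cons => /predU1P[->|/De].
    rewrite big_cons eqxx addrC; congr (_ + _); apply: eq_big_seq => j e_j.
    by case: eqP => // eq_j; move: ne_i; rewrite -eq_j e_j.
  suff main n0 : forall f, W f -> (forall mm, mm \in msupp f -> (wt mm < n0)%N) -> Sp f.
    move=> f Wf; have [|e [c [_ De ->]]] := main (\max_(mm <- msupp f) wt mm).+1 f Wf.
      by move=> mm fmm; rewrite ltnS; apply: leq_bigmax_seq.
    by exists e, c.
  (* The outer induction is on a strict bound for the weights in the support, the inner one on the
     number of monomials of the largest weight allowed. *)
  elim: n0 => [|n0 IH] f Wf f_lt.
    exists [::], (fun=> 0); split=> //; rewrite big_nil; apply/eqP.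
    rewrite -msupp_eq0; case: (msupp f) f_lt => // mm s' /(_ mm (mem_head _ _)).
    by rewrite ltn0.
  have [c le_c] := ubnP (count (fun mm => wt mm == n0) (msupp f)).
  elim: c f Wf f_lt le_c => // c IHc f Wf f_lt le_c.
  have [/hasP[mm fmm /eqP wt_mm]|no] := boolP (has (fun mm => wt mm == n0) (msupp f)); last first.
    apply: IH => // mm fmm; have := f_lt mm fmm; rewrite ltnS leq_eqVlt => /predU1P[wt_mm|//].
    by case/hasP: no; exists mm => //; apply/eqP.
  have [|i Di Mi] := leadW f mm Wf fmm.
    by move=> m' /f_lt; rewrite wt_mm ltnS.
  have [nz_v v_lead] := lead i Di.
  pose b := f@_mm / (v i)@_mm.
  rewrite -(subrK (b *: v i) f); apply: (SpD) => //.
  have f'_mm : (f - b *: v i)@_mm = 0.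
    by rewrite mcoeffB mcoeffZ /b divfK ?subrr // -Mi.
  have f'_supp m' : m' \in msupp (f - b *: v i) -> m' \notin msupp f -> m' \in msupp (v i).
    rewrite !mcoeff_msupp negbK mcoeffB mcoeffZ => nz /eqP f0.
    by move: nz; rewrite f0 sub0r oppr_eq0 mulf_eq0 negb_or => /andP[].
  apply: IHc; first by apply: subW => //; apply: vW.
    move=> m' f'm'; have [/f_lt//|/(f'_supp _ f'm')/v_lead[]] := boolP (m' \in msupp f).
    by rewrite Mi wt_mm ltnS.
  (* The subtraction removes [mm] and creates no monomial of weight [n0]: a new one would come from
     [v i], where [mm] is the only one of that weight. *)
  rewrite -ltnS; apply: leq_trans le_c; rewrite ltnS -!size_filter.
  apply: (@uniq_leq_size _ (mm :: _)).
    rewrite /= filter_uniq ?msupp_uniq // andbT mem_filter mcoeff_msupp f'_mm eqxx.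
    by rewrite andbF.
  move=> m'; rewrite in_cons => /predU1P[->|]; rewrite !mem_filter ?wt_mm ?eqxx //.
  case/andP=> /eqP wt_m' f'm'; rewrite wt_m' eqxx /=.
  apply: contraT => /(f'_supp _ f'm')/v_lead[_]; rewrite Mi wt_mm => /(_ wt_m') eq_m.
  by move: f'm'; rewrite eq_m mcoeff_msupp f'_mm eqxx.
Qed.

(** * Representatives *)

Lemma sum_weight (X Y : finType) (F : X -> Y) : (\sum_y weight F y = #|X|)%N.
Proof.
rewrite -sum1_card (partition_big F predT) //=; apply: eq_bigr => y _.
by rewrite /weight -sum1_card; apply: eq_bigl => x; rewrite inE.
Qed.

Lemma weight_bij (X X' : finType) (Y : eqType) (f : X -> X') (F : X -> Y) (F' : X' -> Y) :
  bijective f -> F =1 F' \o f -> weight F =1 weight F'.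
Proof.
move=> f_bij FE y; rewrite /weight -(on_card_preimset (f := f)).
  by apply: eq_card => x; rewrite !inE FE.
by have [g fK gK] := f_bij; exists g => x _; rewrite ?fK ?gK.
Qed.

Lemma card_box (la : seq nat) : #|{: box la}| = sumn la.
Proof.
rewrite -(sum_weight (@brow la)) sumnE (big_nth 0%N) big_mkord; apply: eq_bigr => e _.
by rewrite -card_box_row; apply: eq_card => b; rewrite !inE -val_eqE.
Qed.

Section Representing.
Variables (la mu : seq nat) (m : nat) (P : box la -> 'I_m) (Q : box mu -> 'I_m).

Lemma mem_fiber (nu : seq nat) (F : box nu -> 'I_m) (i : 'I_m) (b : box nu) :
  F b = i -> b \in fiber F i.
Proof. by move=> Fb; rewrite inE Fb. Qed.

(** A mapping determines the tuple it represents through the rows of its values alone, which is also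
    all that [tableau_mon] sees of it. *)
Lemma represents_row (alpha : box mu -> box la) (S : tableau_tuple Q) :
  represents P alpha S -> forall i b, S i b = brow (alpha (val b)).
Proof. by move=> [_ _ rep] i b; have [ai [ai_val _ ->]] := rep i; rewrite /= -ai_val. Qed.

Lemma represents_picture (alpha : box mu -> box la) (S : tableau_tuple Q) :
  ordered P -> ordered Q -> special_tuple P S -> represents P alpha S ->
  picture P Q alpha.
Proof.
move=> Pord Qord Sspec rep; have rowE := represents_row rep.
have [alpha_bij PalphaE admE] := rep; split=> //; first split=> a b eq_Q.
- move=> eq_r le_c; have [[Srow _] _ _] := Sspec (Q b).
  by have := Srow (exist _ a (mem_fiber eq_Q)) (exist _ b (mem_fiber erefl)); rewrite !rowE; apply.
- move=> eq_c lt_r; have [[_ Scol] _ _] := Sspec (Q b).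
  by have := Scol (exist _ a (mem_fiber eq_Q)) (exist _ b (mem_fiber erefl)); rewrite !rowE; apply.
move=> a b eq_Q; have [ai [ai_val [_ adm] _]] := admE (Q b).
have := adm (exist _ a (mem_fiber eq_Q)) (exist _ b (mem_fiber erefl)).
by rewrite !ai_val.
Qed.

(** The restrictions of [alpha] to the fibers are the diagram mappings demanded by [special], and
    the last hypothesis is their condition (b). *)
Lemma special_of_picture (alpha : box mu -> box la) :
    bijective alpha -> P \o alpha =1 Q ->
    (forall a b, Q a = Q b -> brow a = brow b -> (bcol a <= bcol b)%N ->
       (brow (alpha a) <= brow (alpha b))%N) ->
    (forall a b, Q a = Q b -> bcol a = bcol b -> (brow a < brow b)%N ->
       (brow (alpha a) < brow (alpha b))%N) ->
    (forall a b, Q a = Q b -> bcol (alpha a) = bcol (alpha b) ->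
       (brow (alpha a) < brow (alpha b))%N -> (brow a < brow b)%N) ->
  special_tuple P (fun i (b : boxes (fiber Q i)) => brow (alpha (val b)) : nat).
Proof.
move=> [beta alphaK betaK] PalphaE Srow Scol dec i.
have Qfib (b : boxes (fiber Q i)) : Q (val b) = i.
  by have := valP b; rewrite inE => /eqP.
have ai_mem (b : boxes (fiber Q i)) : alpha (val b) \in fiber P i.
  by apply: mem_fiber; rewrite -[LHS]/((P \o alpha) (val b)) PalphaE Qfib.
have bi_mem (b : boxes (fiber P i)) : beta (val b) \in fiber Q i.
  by apply: mem_fiber; rewrite -PalphaE /= betaK; have := valP b; rewrite inE => /eqP.
pose ai (b : boxes (fiber Q i)) : boxes (fiber P i) := exist _ (alpha (val b)) (ai_mem b).
have ai_bij : bijective ai.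
  exists (fun b : boxes (fiber P i) => exist _ (beta (val b)) (bi_mem b) : boxes (fiber Q i)).
    by move=> b; apply: val_inj; rewrite /= alphaK.
  by move=> b; apply: val_inj; rewrite /= betaK.
split.
- by split=> a b; [apply: Srow | apply: Scol]; rewrite !Qfib.
- exact: weight_bij ai_bij _.
- exists ai; split=> // a b; apply: dec; rewrite !Qfib //.
Qed.

End Representing.

(** * Assembly of the basis from triangularity *)

Theorem theorem4 (k : closedFieldType) (hk : [pchar k] =i pred0)
    (m r s : nat) (hm : (0 < m)%N) (hr : (0 < r)%N) (hs : (0 < s)%N)
    (t : nat) (la mu : seq nat)
    (pla : partition_of t la) (pmu : partition_of t mu)
    (hmu : (size mu <= r)%N) (hla : (size la <= s)%N)
    (Rep : {ffun 'I_m -> nat} -> {ffun box la -> 'I_m} ->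
           {ffun box mu -> 'I_m} -> {set {ffun box mu -> box la}})
    (hRep : forall nu P Q, triple t nu P Q ->
              set_of_representatives P Q (Rep nu P Q)) :
  is_basis
    (fun x : {ffun 'I_m -> nat} * {ffun box la -> 'I_m} *
             {ffun box mu -> 'I_m} * {ffun box mu -> box la} =>
       let: (nu, P, Q, alpha) := x in
       triple t nu P Q /\ alpha \in Rep nu P Q)
    (fun x => let: (nu, P, Q, alpha) := x in
       u_elt k hmu hla Q alpha)
    (@highest_weight_space k m r s
       (fun i => - (nth 0%N mu (rev_ord i))%:Z)
       (fun j => (nth 0%N la j)%:Z)).
Proof.
have [la_sorted _ la_sum] := pla; have [mu_sorted _ mu_sum] := pmu.
have pict nu (P : {ffun box la -> 'I_m}) (Q : {ffun box mu -> 'I_m}) alpha :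
    triple t nu P Q -> alpha \in Rep nu P Q -> picture P Q alpha.
  move=> tr; have [_ Pord Qord _ _] := tr; have [repA _] := hRep _ _ _ tr.
  by move=> /repA[S [Sspec rep]]; apply: represents_picture Sspec rep.
(* [N] exceeds the bound on the third sum of the weight needed by [u_elt_leading], and also [r] and
   [s], so that the keys in [leading_picture] are lexicographic. *)
pose N := (#|{: box mu}| * (r * s) + r + s).+1.
have ltN : (#|{: box mu}| * (r * s) < N)%N by rewrite ltnS -addnA leq_addr.
have le_rN : (r <= N)%N by rewrite /N; lia.
have le_sN : (s <= N)%N by rewrite /N; lia.
pose M (x : {ffun 'I_m -> nat} * {ffun box la -> 'I_m} *
             {ffun box mu -> 'I_m} * {ffun box mu -> box la}) :=
  let: (nu, P, Q, alpha) := x in tableau_mon hmu hla Q alpha.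
apply: (@triangular_basis k _ _ _ _ _ M (mnm_weight N)).
- move=> [[[nu P] Q] alpha] [tr Ralpha].
  by apply: u_elt_highest_weight => //; case: (pict _ _ _ _ tr Ralpha).
- by move=> f g c; apply: highest_weight_sub.
- move=> [[[nu P] Q] alpha] [tr Ralpha].
  exact: (u_elt_leading hk hmu hla (pict _ _ _ _ tr Ralpha) ltN).
- move=> [[[nu P] Q] alpha] [[[nu' P'] Q'] alpha'] [tr Ra] [tr' Ra'] eq_mon.
  have [eqP eqQ eqS] := tableau_mon_inj (pict _ _ _ _ tr Ra) (pict _ _ _ _ tr' Ra') eq_mon.
  move/ffunP: eqP => eqP; move/ffunP: eqQ => eqQ; subst P' Q'.
  have eq_nu : nu = nu'.
    by apply/ffunP => i; have [_ _ _ <- _] := tr; have [_ _ _ <- _] := tr'.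
  subst nu'; congr (_, _).
  have [repA repU] := hRep _ _ _ tr.
  (* Both mappings have the same rows, so they represent the same tuple [S], and the uniqueness of
     representatives identifies them. *)
  have [S [Sspec rep]] := repA _ Ra; have [S' [_ rep']] := repA _ Ra'.
  have [a0 [_ a0_uniq]] := repU S Sspec.
  rewrite -(a0_uniq alpha) // -(a0_uniq alpha') //; split=> //.
  have [a'_bij Pa'E adm'] := rep'; split=> // i; have [ai [ai_val ai_adm S'E]] := adm' i.
  exists ai; split=> // b; rewrite -S'E (represents_row rep) (represents_row rep').
  by rewrite eqS.
move=> f mm hw f_mm mm_max.
have [P [Q [alpha [alpha_bij PalphaE [Pord Qord] [Srow Scol dec] ->]]]] :=
  leading_picture hmu hla hk la_sorted mu_sorted le_rN le_sN hw f_mm mm_max.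
pose nu := [ffun i => weight P i].
have tr : triple t nu P Q.
  split=> // [|i|i]; rewrite ?ffunE //.
    under eq_bigr do rewrite ffunE.
    by rewrite sum_weight card_box.
  by apply: weight_bij alpha_bij _ _ => a; rewrite -PalphaE.
have Sspec := special_of_picture alpha_bij PalphaE Srow Scol dec.
(* The mapping [alpha] is replaced by the chosen representative of its special tuple, which has the
   same rows and hence the same monomial. *)
have [_ /(_ _ Sspec)[alpha' [[Ra' rep'] _]]] := hRep _ _ _ tr.
exists (nu, P, Q, alpha') => //; apply: eq_word_mon => a.
rewrite /tableau_word; congr (enum_rank (_, _, widen_ord _ _)); apply/ord_inj.
by have := represents_row rep' (exist _ a (mem_fiber (erefl (Q a)))).
Qed.
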